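(* The stopping time $\tau$ of any $\delta$-PAC learner satisfies, for the bandit instance with mean vector $\boldsymbol\mu$, $$\mathbb E_{\boldsymbol\mu}[\tau]\;\ge\; T_{\mathcal F}(\boldsymbol\mu)\,\mathbf{kl}(\delta\,\|\,1-\delta),$$ where the characteristic time $T_{\mathcal F}(\boldsymbol\mu)$ is defined by $$T_{\mathcal F}(\boldsymbol\mu)^{-1}=\sup_{\boldsymbol w\in\Pi}\ \inf_{\boldsymbol\lambda\in\Lambda_{\mathcal F}(\boldsymbol\mu)}\ \sum_{a=1}^K w_a\,d(\mu_a,\lambda_a).$$
   Context: Setting. There are $K$ arms. The reward of each arm is distributed according to a sub-Gaussian single-parameter exponential family parametrized by its mean; $d(x,y)$ is the KL divergence between the members of the family with means $x$ and $y$, and $\mathbf{kl}(x\|y)$ is the KL divergence between Bernoulli distributions with means $x$ and $y$. A bandit instance is identified with its vector of means, which lies in the bounded domain $\mathcal D=[\mu_{\min},\mu_{\max}]^K$. $\Delta_{K-1}$ is the probability simplex in $\mathbb R^K$. The set of feasible policies is the non-empty compact set $\mathcal F=\{\boldsymbol\pi\in\Delta_{K-1}: B\boldsymbol\pi\le \boldsymbol c\}$ with $B\in\mathbb R^{N\times K}$ and $\boldsymbol c\in\mathbb R^N$ known. The optimal policy $\boldsymbol\pi^*_{\boldsymbol\mu}=\arg\max_{\boldsymbol\pi\in\mathcal F}\boldsymbol\mu^\top\boldsymbol\pi$ is assumed to be unique. The set of alternative instances is $$\Lambda_{\mathcal F}(\boldsymbol\mu)=\{\boldsymbol\lambda\in\mathcal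 D:\ \max_{\boldsymbol\pi\in\mathcal F}\boldsymbol\lambda^\top\boldsymbol\pi>\boldsymbol\lambda^\top\boldsymbol\pi^*_{\boldsymbol\mu}\}.$$ $\Pi$ is the set of feasible exploration policies: $\Pi=\Delta_{K-1}$ if only the finally recommended policy has to satisfy the constraints (end-of-time constraints), and $\Pi=\mathcal F$ if the exploration policy has to satisfy the constraints in expectation at all times (anytime constraints). At each time step $t$ the learner plays an arm $A_t$, using an exploration policy in $\Pi$, and observes a reward drawn from the distribution of that arm. At a random stopping time $\tau$ it stops and recommends a policy in $\mathcal F$. With $\delta$ the confidence parameter, the learner is $\delta$-PAC if it recommends the unique optimal policy of the instance with probability at least $1-\delta$.
   Formalization: The confidence parameter δ is restricted to 0 < δ ≤ 1/2; for δ > 1/2 the bound is false, since with two arms and δ = 0.9 guessing the optimal arm by a fair coin at time 0 is δ-PAC with E[τ] = 0. *)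

(* Defs.v *)
From HB Require Import structures.
From mathcomp Require Import all_boot all_order all_algebra.
From mathcomp Require Import all_classical all_reals all_analysis.

Set Implicit Arguments.
Unset Strict Implicit.
Unset Printing Implicit Defensive.

Import Order.TTheory GRing.Theory Num.Theory.
Import numFieldNormedType.Exports.

Local Open Scope classical_set_scope.
Local Open Scope charge_scope.
Local Open Scope ring_scope.

Section divergence.
Context d (T : measurableType d) (R : realType).

(* The integrand is ln of the real value of the density, which is positive
   P-almost everywhere, so the convention ln x = 0 for x <= 0 is harmless;
   its negative part is always P-integrable. *)
Definition KL (P Q : probability T R) : \bar R :=
  if `[< P `<< Q >] then
    (\int[P]_x (ln (fine (('d (charge_of_finite_measure P) '/d Q) x)))%:E)%E
  else +oo%E.

End divergence.

Definition bernoulli_kl (R : realType) (x y : R) : \bar R :=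
  KL (bernoulli_prob x : probability bool R) (bernoulli_prob y).

(* A canonical one-parameter exponential family indexed by the mean m:
   family m has density exp (natpar m * x - logpart (natpar m)) with respect to
   the reference measure. Since family m has mass 1, logpart is necessarily
   the log-partition function on the natural parameters in use. Nothing is
   required of family m when m is not in the mean space. *)
Record exp_family (R : realType) := ExpFamily {
  mean_space : set R ;
  reference : {measure set R -> \bar R} ;
  natpar : R -> R ;
  logpart : R -> R ;
  family :> R -> probability R R ;
  family_density : forall m, mean_space m ->
    forall C : set R, measurable C ->
    family m C =
      (\int[reference]_(x in C) (expR (natpar m * x - logpart (natpar m)))%:E)%E ;
  family_integrable : forall m, mean_space m ->
    (family m).-integrable setT (fun x : R => x%:E) ;
  family_mean : forall m, mean_space m ->
    ('E_(family m)[fun x : R => x])%E = m%:E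
}.

Definition sub_gaussian (R : realType) (P : probability R R) (m : R) : Prop :=
  exists sigma : R, forall s : R,
    ('E_P[fun x : R => expR (s * (x - m))] <=
      (expR (sigma ^+ 2 * s ^+ 2 / 2))%:E)%E.

Definition sub_gaussian_family (R : realType) (nu : exp_family R) : Prop :=
  forall m, mean_space nu m -> sub_gaussian (nu m) m.

Section policies.
Context (R : realType) (K N : nat).
Implicit Types (F : set 'cV[R]_K) (p l mu : 'cV[R]_K).

Definition value l p : R := (l^T *m p) ord0 ord0.

Definition simplex : set 'cV[R]_K :=
  [set p | (forall a, 0 <= p a ord0) /\ \sum_(a < K) p a ord0 = 1].

Definition feasible (B : 'M[R]_(N, K)) (c : 'cV[R]_N) : set 'cV[R]_K :=
  [set p | simplex p /\ forall i, (B *m p) i ord0 <= c i ord0].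

Definition instances (mu_min mu_max : R) : set 'cV[R]_K :=
  [set l | forall a, mu_min <= l a ord0 <= mu_max].

Definition optimal F l : set 'cV[R]_K :=
  [set p | F p /\ forall q, F q -> value l q <= value l p].

(* For F non-empty and compact the supremum is a maximum. *)
Definition alternatives F mu_min mu_max pistar : set 'cV[R]_K :=
  [set l | instances mu_min mu_max l /\
           value l pistar < sup [set value l p | p in F]].

Inductive constraint_mode := EndOfTime | Anytime.

Definition exploration_set (mode : constraint_mode) F : set 'cV[R]_K :=
  match mode with EndOfTime => simplex | Anytime => F end.

(* Values are in the extended reals, with inf set0 = +oo, 0^-1 = +oo and
   +oo^-1 = 0. *)
Definition char_time (nu : exp_family R) (Pi Lambda : set 'cV[R]_K) mu : \bar R :=
  inve (ereal_sup [set
    ereal_inf [set (\sum_(a < K)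
                     (w a ord0)%:E * KL (nu (mu a ord0)) (nu (l a ord0)))%E
              | l in Lambda]
  | w in Pi]).

End policies.

(* The random objects produced by a learner on a sample space Omega common to
   all instances. Rounds are numbered from 0. The seed carries all the internal
   randomness that the learner may use besides the draw of the arms. The value
   None of stop means that the learner never stops; otherwise stop is the number
   of rounds played. The processes arm, reward and explore are also
   defined after the stopping time, where they have no influence. *)
Record learner (R : realType) (K : nat) d (Omega : measurableType d)
    du (U : measurableType du) := Learner {
  seed : Omega -> U ;
  seed_law : probability U R ;
  explore : nat -> Omega -> 'cV[R]_K ;
  arm : nat -> Omega -> 'I_K ;
  reward : nat -> Omega -> R ;
  stop : Omega -> option nat ;
  recommend : Omega -> 'cV[R]_K
}.

Section bandit.
Context (R : realType) (K : nat) d (Omega : measurableType d)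
  du (U : measurableType du).
Variable L : learner R K Omega U.

(* The sigma-algebra generated by the seed and the first t rounds. *)
Definition history (t : nat) : set_system Omega :=
  <<s preimage_set_system setT (seed L) measurable `|`
      \bigcup_(s in [set s | (s < t)%N])
        (preimage_set_system setT (arm L s) setT `|`
         preimage_set_system setT (reward L s) measurable) >>.

Definition stopped_by (t : nat) : set Omega :=
  [set w | exists2 n, stop L w = Some n & (n <= t)%N].

Definition stop_time (w : Omega) : \bar R :=
  if stop L w is Some n then n%:R%:E else +oo%E.

Record admissible (Pi F : set 'cV[R]_K) : Prop := Admissible {
  seed_measurable : measurable_fun setT (seed L) ;
  arm_measurable : forall t a, measurable (arm L t @^-1` [set a]) ;
  reward_measurable : forall t, measurable_fun setT (reward L t) ;
  explore_predictable : forall t a (C : set R), measurable C ->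
    history t [set w | C (explore L t w a ord0)] ;
  explore_feasible : forall t w, Pi (explore L t w) ;
  stop_stopping_time : forall t, history t (stopped_by t) ;
  recommend_measurable : forall t a (C : set R), measurable C ->
    history t (stopped_by t `&` [set w | C (recommend L w a ord0)]) ;
  recommend_feasible : forall w, stop L w <> None -> F (recommend L w)
}.

(* P is a law of the interaction with the instance l: the seed does not depend
   on l and, conditionally on the history before round t, the arm A_t is drawn
   from the exploration policy and the reward from the distribution of A_t,
   i.e. P(A_t = a, X_t \in C | history t) = explore_t(a) * nu_(l_a)(C). *)
Record bandit_law (nu : exp_family R) (l : 'cV[R]_K)
    (P : probability Omega R) : Prop := BanditLaw {
  seed_distribution : forall V : set U, measurable V ->
    P (seed L @^-1` V) = seed_law L V ;
  round_distribution : forall t E, history t E ->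
    forall a (C : set R), measurable C ->
    P (E `&` arm L t @^-1` [set a] `&` reward L t @^-1` C) =
      ((\int[P]_(w in E) (explore L t w a ord0)%:E) * nu (l a ord0) C)%E
}.

(* The requirement only bears on the instances with a unique optimal policy,
   and never stopping counts as an error. As a lower bound on the stopping time,
   bernoulli_kl delta (1 - delta) is meaningful for delta <= 1 / 2 only: it grows
   again for larger delta, for which guessing at time 0 can be delta-PAC. *)
Definition pac (F D : set 'cV[R]_K) (P : 'cV[R]_K -> probability Omega R)
    (delta : R) : Prop :=
  forall l p, D l -> optimal F l = [set p] ->
    ((1 - delta)%:E <=
      P l [set w | stop L w <> None /\ recommend L w = p])%E.

End bandit.

(* Main.v *)
Require Import Defs.
From HB Require Import structures.
From mathcomp Require Import all_boot all_order all_algebra.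
From mathcomp Require Import all_classical all_reals measurable_realfun all_analysis.
From mathcomp Require Import ring lra.

Set Implicit Arguments.
Unset Strict Implicit.
Unset Printing Implicit Defensive.

Import Order.TTheory GRing.Theory Num.Theory.
Import numFieldNormedType.Exports.

Local Open Scope classical_set_scope.
Local Open Scope ring_scope.

(* Fix a horizon t and an alternative l, whose optimal policy is not pistar, and
   let M be the log-likelihood ratio of mu against l for the rounds played before
   min(tau, t).  The law of the interaction under l has density exp(-M) with
   respect to the one under mu on the events decided by the stopped history.
   Applying exp u >= 1 + u at u = c - M on the event {tau <= t, pistar is
   recommended} and at u = -c - M outside it, with c = ln((1-delta)/delta), bounds
   E_mu M from below by c (2 p_t - 1), where p_t is the probability under mu of
   that event; p_t tends to at least 1 - delta.  On the other hand E_mu M is the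
   sum over the arms of the expected number of pulls times d(mu_a, l_a), and the
   normalized numbers of pulls form a policy in Pi.

   An alternative need not have a unique optimal policy, and then the learner
   promises nothing about it.  It is approximated by instances that do: the
   maximizer p of the strictly convex function q |-> l.q + e|q|^2/2 over F is the
   unique optimum of l + e p.  The divergence from mu stays under control because
   each coordinate moves towards mu, where only boundedness of the natural
   parameter is needed. *)

(** * Integrals against image measures *)

Section transfer.
Import HBNNSimple.

(** Monotone convergence along simple approximations of [f]. The limit sees [u] and [phi] only
    through integrals of [u] over preimages by [phi], which is what lets two such integrals be
    compared. *)
Lemma ge0_integral_limn_nnsfun_approx d1 d3 (T1 : measurableType d1)
    (S : measurableType d3) (R : realType) (mu : {measure set T1 -> \bar R})
    (phi : T1 -> S) (u : T1 -> R) (f : S -> R) (mf : measurable_fun setT (EFin \o f : S -> \bar R)) :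
  measurable_fun setT phi -> measurable_fun setT u ->
  (forall x, 0 <= u x) -> (forall s, 0 <= f s) ->
  (\int[mu]_x (f (phi x) * u x)%:E =
  limn (fun n => \sum_(y \in range (nnsfun_approx measurableT mf n))
    y%:E * \int[mu]_(x in phi @^-1` (nnsfun_approx measurableT mf n @^-1` [set y])) (u x)%:E))%E.
Proof.
move=> mphi mu_ u0 f0.
set f_ := nnsfun_approx measurableT mf.
have mEu : measurable_fun setT (EFin \o u : T1 -> \bar R) by exact/measurable_EFinP.
have mpre n y : measurable (phi @^-1` (f_ n @^-1` [set y])).
  by rewrite -[X in measurable X]setTI; apply: mphi.
transitivity (\int[mu]_x limn (fun n => (f_ n (phi x))%:E * (u x)%:E))%E.
  apply: eq_integral => x _; apply/esym/cvg_lim => //.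
  rewrite EFinM; apply: cvgeZr => //.
  by apply: (cvg_nnsfun_approx measurableT mf) => // t _; rewrite lee_fin.
rewrite monotone_convergence//; last 3 first.
- move=> n; apply: emeasurable_funM => //.
  by apply/measurable_EFinP; apply: measurableT_comp => //; exact: measurable_funP.
- by move=> n x _; apply: mule_ge0; rewrite lee_fin.
- move=> x _ m n mn; rewrite lee_wpmul2r// ?lee_fin//.
  exact/lefP/nd_nnsfun_approx.
apply/congr_lim/funext => n.
transitivity (\int[mu]_x (\sum_(y \in range (f_ n))
   (y%:E * ((EFin \o u) \_ (phi @^-1` (f_ n @^-1` [set y]))) x)))%E.
  apply: eq_integral => x _; rewrite (fimfunE (f_ n)) -fsumEFin//.
  rewrite ge0_mule_fsuml//; last first.
    by move=> y; rewrite EFinM nnfun_muleindic_ge0.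
  apply: eq_fsbigr => y _; rewrite EFinM -muleA; congr (_ * _)%E.
  by rewrite epatch_indic/= muleC.
rewrite ge0_integral_fsum//.
- apply: eq_fsbigr => y; rewrite inE => -[s _ fsy].
  rewrite ge0_integralZl//.
  + by rewrite [in RHS]integral_mkcond.
  + apply/(measurable_restrictT _ _).1 => //; exact: measurable_funTS.
  + by move=> x _; apply: erestrict_ge0 => t _ /=; rewrite lee_fin.
  + by rewrite -fsy lee_fin.
- move=> y; apply: measurable_funeM.
  apply/(measurable_restrictT _ _).1 => //; exact: measurable_funTS.
(* A nonnegative simple function takes no negative value, so for [y < 0] the preimage is empty and
   the term vanishes. *)
- move=> y x _; have [y0|y0] := leP 0 y.
    rewrite mule_ge0// ?lee_fin//.
    by apply: erestrict_ge0 => t _ /=; rewrite lee_fin.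
  by rewrite epatch_indic/= preimage_nnfun0// preimage_set0 indicE in_set0 mule0 mule0.
Qed.

(* With phi and psi the identity into a coarser sigma-algebra, this extends an
   identity between conditional expectations from events to functions. *)
Lemma ge0_integral_transfer d1 d2 d3 (T1 : measurableType d1)
    (T2 : measurableType d2) (S : measurableType d3) (R : realType)
    (mu1 : {measure set T1 -> \bar R}) (mu2 : {measure set T2 -> \bar R})
    (phi : T1 -> S) (psi : T2 -> S) (u : T1 -> R) (v : T2 -> R) (f : S -> R) :
  measurable_fun setT phi -> measurable_fun setT psi ->
  measurable_fun setT u -> measurable_fun setT v ->
  (forall x, 0 <= u x) -> (forall x, 0 <= v x) ->
  (forall E, measurable E ->
    \int[mu1]_(x in phi @^-1` E) (u x)%:E =
    \int[mu2]_(x in psi @^-1` E) (v x)%:E)%E ->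
  measurable_fun setT f -> (forall s, 0 <= f s) ->
  (\int[mu1]_x (f (phi x) * u x)%:E = \int[mu2]_x (f (psi x) * v x)%:E)%E.
Proof.
move=> mphi mpsi mu_ mv u0 v0 uv mf f0.
have mEf : measurable_fun setT (EFin \o f : S -> \bar R) by exact/measurable_EFinP.
rewrite (ge0_integral_limn_nnsfun_approx mu1 mEf)// (ge0_integral_limn_nnsfun_approx mu2 mEf)//.
apply/congr_lim/funext => n; apply: eq_fsbigr => y _; rewrite uv//.
Qed.

End transfer.

(** * Perturbation to a unique optimal policy *)

Section unique_optimum.
Context (R : realType) (K : nat).
Implicit Types (F : set 'cV[R]_K) (l p q : 'cV[R]_K).

Lemma valueE l p : value l p = \sum_(a < K) l a ord0 * p a ord0.
Proof. by rewrite /value mxE; apply: eq_bigr => a _; rewrite mxE. Qed.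

Lemma simplex_le1 p a : simplex p -> p a ord0 <= 1.
Proof.
move=> [p0 <-]; rewrite (bigD1 a)//= lerDl.
by apply: sumr_ge0 => b _; exact: p0.
Qed.

Lemma value_le_simplex l p e : (forall a, `|l a ord0| <= e) -> simplex p ->
  `|value l p| <= e.
Proof.
move=> le [p0 p1]; rewrite valueE -[leRHS]mulr1 -p1 mulr_sumr.
apply: (le_trans (ler_norm_sum _ _ _)); apply: ler_sum => a _.
by rewrite normrM (ger0_norm (p0 a)) ler_wpM2r.
Qed.

(** A closed subset of the unit cube. The compactness of cubes and the extreme value theorem are
    used on row vectors, hence the transpose. *)
Lemma feasible_compact N (B : 'M[R]_(N, K)) (c : 'cV[R]_N) :
  compact [set r : 'rV[R]_K | feasible B c r^T].
Proof.
pose cube := [set r : 'rV[R]_K | forall i, `[0, 1]%classic (r ord0 i)].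
have cubeC : compact cube.
  by apply: (@rV_compact R K (fun=> `[0, 1]%classic)) => _; exact: segment_compact.
apply: subclosed_compact cubeC _; last first.
  by move=> r [rs _] a; have := simplex_le1 a rs; case: rs => /(_ a); rewrite /= in_itv/= !mxE => -> _ ->.
have -> : [set r : 'rV[R]_K | feasible B c r^T] =
  (\bigcap_a (fun r : 'rV[R]_K => r ord0 a) @^-1` [set x | 0 <= x]) `&`
  ((fun r : 'rV[R]_K => \sum_(a < K) r ord0 a) @^-1` [set 1]) `&`
  (\bigcap_i (fun r : 'rV[R]_K => \sum_(a < K) B i a * r ord0 a) @^-1`
     [set x | x <= c i ord0]).
  have sumE (r : 'rV[R]_K) : \sum_(a < K) r^T a ord0 = \sum_(a < K) r ord0 a.
    by apply: eq_bigr => a _; rewrite mxE.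
  have mulE (r : 'rV[R]_K) i : (B *m r^T) i ord0 = \sum_(a < K) B i a * r ord0 a.
    by rewrite mxE; apply: eq_bigr => a _; rewrite mxE.
  apply/seteqP; split => r /=.
    move=> [[r0 r1] Br]; split; last by move=> i _ /=; rewrite -mulE.
    by split; [move=> a _ /=; have := r0 a; rewrite mxE|rewrite -sumE].
  move=> [[r0 r1] Br]; split; last by move=> i; rewrite mulE; exact: Br.
  by split; [move=> a; rewrite mxE; exact: r0|rewrite sumE].
have closed_pre (f : 'rV[R]_K -> R) D : continuous f -> closed D -> closed (f @^-1` D).
  by move=> /continuous_closedP; exact.
have cc a : continuous (fun y : 'rV[R]_K => y ord0 a).
  by move=> y; exact: coord_continuous.
refine (closedI _ _); first refine (closedI _ _).
- by refine (closed_bigI _) => a _; apply: closed_pre; [exact: cc|exact: closed_ge].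
- apply: closed_pre; last exact: closed_eq.
  by apply: continuous_big => [|a _]; [exact: add_continuous|exact: cc].
- refine (closed_bigI _) => i _; apply: closed_pre; last exact: closed_le.
  apply: continuous_big => [|a _ y]; first exact: add_continuous.
  by apply: continuousM; [exact: cst_continuous|exact: cc].
Qed.

(* The point of F that is extremal for the strictly convex function
   q |-> value l q + e / 2 |q|^2 is the only optimum of its gradient. *)
Lemma unique_optimum_perturbation N (B : 'M[R]_(N, K)) (c : 'cV[R]_N) l (e : R) :
  0 < e -> feasible B c !=set0 ->
  exists2 p, feasible B c p & optimal (feasible B c) (l + e *: p) = [set p].
Proof.
move=> e0 [p0 Fp0].
pose f (r : 'rV[R]_K) := \sum_(a < K) (l a ord0 * r ord0 a + e / 2 * (r ord0 a * r ord0 a)).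
have cf : continuous f.
  have cc a : continuous (fun y : 'rV[R]_K => y ord0 a) by move=> y; exact: coord_continuous.
  apply: continuous_big => [|a _ y]; first exact: add_continuous.
  have c1 : continuous (fun z : 'rV[R]_K => l a ord0 * z ord0 a).
    by move=> z; apply: continuousM; [exact: cst_continuous|exact: cc].
  have c2 : continuous (fun z : 'rV[R]_K => z ord0 a * z ord0 a).
    by move=> z; apply: continuousM; exact: cc.
  have c3 : continuous (fun z : 'rV[R]_K => e / 2 * (z ord0 a * z ord0 a)).
    by move=> z; apply: (@continuousM _ _ (cst (e / 2)) _ z); [exact: cst_continuous|exact: c2].
  exact: (continuousD (c1 y) (c3 y)).
have [|r] := EVT_max_rV _ (@feasible_compact N B c) (continuous_subspaceT cf).
  by exists p0^T => /=; rewrite trmxK.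
rewrite inE => /= Fr maxr; exists r^T => //.
(* Expanding the square turns the two sides into [f q^T] and [f r], each plus [e / 2] times the
   squared norm of [r]. The square kept on the left forces uniqueness. *)
have key q : feasible B c q ->
    value (l + e *: r^T) q + e / 2 * \sum_(a < K) (q a ord0 - r ord0 a) ^+ 2
    <= value (l + e *: r^T) r^T.
  move=> Fq; have : f q^T <= f r by apply: maxr; rewrite inE/= trmxK.
  rewrite /f !valueE mulr_sumr -big_split/= -subr_ge0 -sumrB => H.
  rewrite -subr_ge0 -sumrB; apply: le_trans H _.
  by apply: ler_sum => a _; rewrite !mxE; lra.
have sq0 q : 0 <= \sum_(a < K) (q a ord0 - r ord0 a) ^+ 2.
  by apply: sumr_ge0 => a _; exact: sqr_ge0.
apply/seteqP; split => [q [Fq maxq]|_ ->] /=.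
  have := le_trans (key q Fq) (maxq _ Fr); rewrite gerDl pmulr_rle0 ?divr_gt0//.
  move=> sq; have /eqP : \sum_(a < K) (q a ord0 - r ord0 a) ^+ 2 == 0.
    by rewrite eq_le sq sq0.
  move/psumr_eq0P => /(_ (fun a _ => sqr_ge0 _)) H.
  apply/matrixP => a b; rewrite mxE (ord1 b); apply/eqP.
  by rewrite -subr_eq0 -sqrf_eq0 H.
split => // q Fq; apply: le_trans (key q Fq).
by rewrite lerDl mulr_ge0// divr_ge0// ltW.
Qed.

End unique_optimum.

Section alternative_perturbation.
Context (R : realType) (K N : nat).

Lemma exists_le_finite (r : 'I_K -> R) :
  (forall a, 0 < r a) -> exists2 e, 0 < e & forall a, e <= r a.
Proof.
move=> r0; exists (\big[Num.min/1]_(a < K) r a); last first.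
  by move=> a; exact: bigmin_le.
exact: lt_bigmin.
Qed.

(* Every coordinate moves from l towards mu, or in any direction allowed by the
   domain where they coincide. *)
Lemma alternative_perturbation (B : 'M[R]_(N, K)) (c : 'cV[R]_N)
    (mu_min mu_max : R) (mu l pistar : 'cV[R]_K) (eps : R) :
  instances mu_min mu_max mu -> optimal (feasible B c) mu = [set pistar] ->
  alternatives (feasible B c) mu_min mu_max pistar l -> 0 < eps ->
  exists l' p', [/\ instances mu_min mu_max l', optimal (feasible B c) l' = [set p'],
    p' <> pistar &
    forall a, 0 <= (mu a ord0 - l a ord0) * (l' a ord0 - l a ord0) /\
      `|l' a ord0 - l a ord0| <= eps].
Proof.
move=> Dmu optmu [Dl supl] eps0.
have [Fstar maxstar] : optimal (feasible B c) mu pistar by rewrite optmu.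
clear optmu.
have [q Fq lq] : exists2 q, feasible B c q & value l pistar < value l q.
  apply: contrapT => H; move: supl; rewrite ltNge => /negP; apply.
  apply: ge_sup; first by exists (value l pistar), pistar.
  move=> _ [q Fq <-]; rewrite leNgt; apply/negP => lq.
  by apply: H; exists q.
(* Otherwise the domain has at most one point, so [l = mu] and [pistar] is optimal for [l], against
   [lq]. *)
have mm : mu_min < mu_max.
  rewrite ltNge; apply/negP => mm.
  suff lmu : l = mu by move: lq; rewrite lmu ltNge maxstar.
  apply/matrixP => a b; rewrite (ord1 b).
  by have := Dl a; have := Dmu a; move=> /andP[? ?] /andP[? ?]; lra.
pose up a := (l a ord0 < mu a ord0) || ((l a ord0 == mu a ord0) && (l a ord0 < mu_max)).
(* Distance from [l] to the end of the domain towards which coordinate [a] is moved. *)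
pose room a := if up a then mu_max - l a ord0 else l a ord0 - mu_min.
have room0 a : 0 < room a.
  have /andP[la1 la2] := Dl a; have /andP[ma1 ma2] := Dmu a.
  rewrite /room /up; case: (ltgtP (l a ord0) (mu a ord0)) => /= lm; [lra|lra|].
  by case: (ltP (l a ord0) mu_max) => ?; lra.
have [e1 e10 e1r] := exists_le_finite room0.
pose gap := value l q - value l pistar.
have gap0 : 0 < gap by rewrite subr_gt0.
(* A move of at most [e] per coordinate changes every value on the simplex by at most [e], so
   [gap / 3] keeps [q] strictly better than [pistar] for [l']; [e1] keeps [l'] in the domain and
   [eps] keeps it close to [l]. *)
pose e := Num.min e1 (Num.min eps (gap / 3)).
have e0 : 0 < e by rewrite !lt_min e10 eps0/= divr_gt0.
have ee1 : e <= e1 by rewrite !ge_min lexx.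
have eeps : e <= eps by rewrite !ge_min lexx orbT.
have egap : e <= gap / 3 by rewrite !ge_min lexx !orbT.
(* Adding [(e / 2) *: p'] only raises coordinates, by at most [e / 2]; those that must go down are
   first lowered by [e]. *)
pose l0 : 'cV[R]_K := \col_a (if up a then l a ord0 else l a ord0 - e).
have [|p' Fp' optp'] := @unique_optimum_perturbation R K N B c l0 (e / 2) _ (ex_intro _ _ Fstar).
  by rewrite divr_gt0.
set l' := l0 + _ in optp'.
have Dl'l a : if up a then 0 <= l' a ord0 - l a ord0 <= e else - e <= l' a ord0 - l a ord0 <= 0.
  clear optp'; have p'0 : 0 <= p' a ord0 by case: Fp' => -[+ _] _; exact.
  have p'1 : p' a ord0 <= 1 by apply: simplex_le1; case: Fp'.
  have ep0 : 0 <= e / 2 * p' a ord0 by rewrite mulr_ge0// divr_ge0// ltW.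
  have ep1 : e / 2 * p' a ord0 <= e / 2 by rewrite ler_piMr// divr_ge0// ltW.
  by rewrite !mxE; case: (up a); apply/andP; split; lra.
have l'le a : `|l' a ord0 - l a ord0| <= e.
  by clear optp'; rewrite ler_norml; have := Dl'l a; case: (up a) => /andP[? ?]; apply/andP; split; lra.
exists l', p'; split => //.
- clear optp'; move=> a; have := Dl'l a; have := e1r a; rewrite /room; have := Dl a.
  by case: (up a) => /andP[? ?] ? /andP[? ?]; apply/andP; split; lra.
- move=> p'E; have [_ maxp'] : optimal (feasible B c) l' pistar by rewrite optp' p'E.
  clear optp'.
  have := maxp' q Fq.
  have vB (p : 'cV[R]_K) : value l' p = value l p + value (l' - l) p.
    by rewrite /value linearB/= mulmxBl !mxE; ring.
  rewrite !vB.
  have close p : feasible B c p -> `|value (l' - l) p| <= e.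
    move=> [sp _]; apply: value_le_simplex sp => a; rewrite !mxE.
    by have := l'le a; rewrite !mxE.
  have := close _ Fq; have := close _ Fstar; rewrite !ler_norml => /andP[? ?] /andP[? ?].
  by move: egap; rewrite /gap => ?; lra.
- move=> a; split; last exact: le_trans (l'le a) eeps.
  have := Dl'l a; rewrite /up; case: (ltgtP (l a ord0) (mu a ord0)) => /= lm.
  + by move=> /andP[? ?]; rewrite mulr_ge0// subr_ge0// ltW.
  + by move=> /andP[? ?]; rewrite mulr_le0// subr_le0// ltW.
  + by rewrite lm subrr mul0r.
Qed.

End alternative_perturbation.

(** * Divergence in exponential families *)

Section divergence.
Context d (T : measurableType d) (R : realType).
Local Open Scope charge_scope.

(** The Radon-Nikodym derivative is determined [Q]-almost everywhere only; domination carries its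
    equality with [expR (g x)] over to [P], where [ln] undoes the exponential. *)
Lemma KL_density (P Q : probability T R) (g : T -> R) :
  measurable_fun setT g ->
  (forall C, measurable C -> P C = \int[Q]_(x in C) (expR (g x))%:E)%E ->
  KL P Q = (\int[P]_x (g x)%:E)%E.
Proof.
move=> mg PE; have PQ : P `<< Q.
  apply/null_content_dominatesP => C mC QC0; rewrite PE//.
  apply: null_set_integral => //; apply/measurable_EFinP.
  by apply: measurableT_comp => //; exact: measurable_funTS.
have mexp : measurable_fun setT (fun x => (expR (g x))%:E).
  by apply/measurable_EFinP; apply: measurableT_comp.
rewrite /KL asboolT//.
have mRN : measurable_fun setT ('d (charge_of_finite_measure P) '/d Q).
  by apply: measurable_int; exact: Radon_Nikodym_integrable.
have aeQ : ae_eq Q setT (fun x => (expR (g x))%:E) ('d (charge_of_finite_measure P) '/d Q).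
  apply: integral_ae_eq => //.
    apply/integrableP; split=> //.
    under eq_integral do rewrite gee0_abs ?lee_fin ?expR_ge0//.
    by rewrite -PE// probability_setT ltry.
  by move=> E _ mE; rewrite -PE// -Radon_Nikodym_integral.
have aeP := null_dominates_ae_eq measurableT PQ aeQ.
apply: ae_eq_integral => //.
- apply/measurable_EFinP; apply: measurableT_comp; first exact: measurable_ln.
  exact: measurableT_comp.
- exact/measurable_EFinP.
- apply: filterS aeP => x /(_ I) <- _ /=.
  by rewrite expRK.
Qed.

End divergence.

Lemma integral_indicr d (T : measurableType d) (R : realType)
    (mu : {measure set T -> \bar R}) (D : set T) (f : T -> R) :
  (\int[mu]_(x in D) (f x)%:E = \int[mu]_x (f x * \1_D x)%:E)%E.
Proof.
by rewrite integral_mkcond; apply: eq_integral => x _; rewrite epatch_indic/= EFinM.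
Qed.

Lemma ge0_integral_density d (T : measurableType d) (R : realType)
    (P Q : {measure set T -> \bar R}) (h f : T -> R) (D : set T) :
  measurable_fun setT h -> (forall x, 0 <= h x) ->
  (forall C, measurable C -> P C = \int[Q]_(x in C) (h x)%:E)%E ->
  measurable D -> measurable_fun setT f -> (forall x, 0 <= f x) ->
  (\int[P]_(x in D) (f x)%:E = \int[Q]_(x in D) (f x * h x)%:E)%E.
Proof.
move=> mh h0 PE mD mf f0; rewrite (integral_indicr P D) (integral_indicr Q D).
under eq_integral do rewrite -[(f _ * _)%R]mulr1.
under [RHS]eq_integral do rewrite -mulrA [(h _ * _)%R]mulrC mulrA.
apply: (ge0_integral_transfer (phi := id) (psi := id)
  (f := fun x => f x * \1_D x)) => //.
- by move=> E mE; rewrite preimage_id integral_cst// mul1e PE.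
- by apply: measurable_funM.
- by move=> s; rewrite mulr_ge0.
Qed.

Section exp_family_divergence.
Context (R : realType) (nu : exp_family R).

Definition loglr (m m' x : R) :=
  (natpar nu m - natpar nu m') * x -
  (logpart nu (natpar nu m) - logpart nu (natpar nu m')).

(** The log-density [loglr] is affine in the reward, so its expectation under the member of mean [m]
    is its value at [m]. This is the divergence as a real number. *)
Definition kld (m m' : R) := loglr m m' m.

Lemma measurable_loglr m m' : measurable_fun setT (loglr m m').
Proof. by apply: measurable_funB => //; exact: measurable_funM. Qed.

Variables m m' : R.
Hypotheses (mm : mean_space nu m) (mm' : mean_space nu m').

Lemma family_loglr C : measurable C ->
  (nu m C = \int[nu m']_(x in C) (expR (loglr m m' x))%:E)%E.
Proof.
move=> mC.
rewrite (ge0_integral_density (Q := reference nu) (h := fun x =>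
  expR (natpar nu m' * x - logpart nu (natpar nu m'))))//.
- rewrite family_density//; apply: eq_integral => x _.
  by rewrite -expRD /loglr; congr (expR _)%:E; ring.
- by apply: measurableT_comp => //; apply: measurable_funB => //; exact: measurable_funM.
- by move=> D mD; exact: family_density.
- by apply: measurableT_comp => //; exact: measurable_loglr.
Qed.

Lemma integrable_loglr m1 m2 :
  (nu m).-integrable setT (fun x => (loglr m1 m2 x)%:E).
Proof.
rewrite /loglr; under eq_fun do rewrite EFinB EFinM.
apply: integrableB => //; last exact: finite_measure_integrable_cst.
by apply: integrableZl => //; exact: family_integrable.
Qed.

Lemma integral_loglr : (\int[nu m]_x (loglr m m' x)%:E = (kld m m')%:E)%E.
Proof.
have ix := family_integrable mm.
rewrite /kld /loglr; under eq_integral do rewrite EFinB EFinM.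
rewrite integralB//; last 2 first.
- exact: integrableZl.
- exact: finite_measure_integrable_cst.
rewrite integralZl// integral_cst//. rewrite [X in (_ - _ * X)%E](probability_setT (nu m)) mule1.
have := family_mean mm; rewrite unlock => ->.
by rewrite -EFinM -EFinB.
Qed.

Lemma KL_family : KL (nu m) (nu m') = (kld m m')%:E.
Proof.
rewrite (KL_density (measurable_loglr m m')); first exact: integral_loglr.
exact: family_loglr.
Qed.

End exp_family_divergence.

Section exp_family_monotone.
Context (R : realType) (nu : exp_family R).
Variables m m' : R.
Hypotheses (mm : mean_space nu m) (mm' : mean_space nu m').

(** Gibbs' inequality: integrate [1 + u <= expR u] at [u = loglr nu m' m x] against [nu m]; the
    right side integrates to the total mass of [nu m']. *)
Lemma kld_ge0 : 0 <= kld nu m m'.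
Proof.
have e1 : (\int[nu m]_x (expR (loglr nu m' m x))%:E = 1)%E.
  by rewrite -family_loglr//; exact: (probability_setT (nu m')).
have : (\int[nu m]_x (1 - loglr nu m m' x)%:E <=
        \int[nu m]_x (expR (loglr nu m' m x))%:E)%E.
  apply: le_integral => //.
  - under eq_fun do rewrite EFinB.
    apply: integrableB => //; first exact: finite_measure_integrable_cst.
    exact: integrable_loglr.
  - apply/integrableP; split.
      by apply/measurable_EFinP; apply: measurableT_comp => //; exact: measurable_loglr.
    under eq_integral do rewrite gee0_abs ?lee_fin ?expR_ge0//.
    by rewrite e1 ltry.
  - move=> x _; rewrite lee_fin (_ : loglr nu m' m x = - loglr nu m m' x).
      exact: expR_ge1Dx.
    by rewrite /loglr; ring.
under eq_integral do rewrite EFinB.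
rewrite e1 integralB//; last 2 first.
- exact: finite_measure_integrable_cst.
- exact: integrable_loglr.
rewrite integral_cst// [X in (_ * X - _)%E](probability_setT (nu m)) mule1 integral_loglr//.
by rewrite -EFinB lee_fin gerBl.
Qed.

End exp_family_monotone.

(** The three-point identity of Bregman divergences. It isolates a product whose sign is known when
    [m2] lies on the side of [m] as seen from [m1]. *)
Lemma kld_diff (R : realType) (nu : exp_family R) (m m1 m2 : R) :
  kld nu m m2 - kld nu m m1 =
  kld nu m1 m2 - (m - m1) * (natpar nu m2 - natpar nu m1).
Proof. by rewrite /kld /loglr; ring. Qed.

(** The product is the symmetrized divergence [kld nu m m' + kld nu m' m]. *)
Lemma natpar_monotone (R : realType) (nu : exp_family R) (m m' : R) :
  mean_space nu m -> mean_space nu m' ->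
  0 <= (m - m') * (natpar nu m - natpar nu m').
Proof.
move=> mm mm'; have := kld_ge0 mm mm'; have := kld_ge0 mm' mm.
by rewrite /kld /loglr => ? ?; nra.
Qed.

(* By monotonicity the natural parameter is bounded on a segment of means, so
   the divergence is Lipschitz when the second mean moves towards the first. *)
Lemma kld_towards (R : realType) (nu : exp_family R) (mu_min mu_max : R) :
  `[mu_min, mu_max] `<=` mean_space nu ->
  exists2 C, 0 <= C & forall m m1 m2, mu_min <= m <= mu_max ->
    mu_min <= m1 <= mu_max -> mu_min <= m2 <= mu_max ->
    0 <= (m - m1) * (m2 - m1) ->
    kld nu m m2 <= kld nu m m1 + C * `|m2 - m1|.
Proof.
move=> sub.
have inspace x : mu_min <= x <= mu_max -> mean_space nu x.
  by move=> x1; apply: sub; rewrite /= in_itv.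
have mono x y : mu_min <= x <= mu_max -> mu_min <= y <= mu_max -> x <= y ->
    natpar nu x <= natpar nu y.
  move=> Dx Dy; rewrite le_eqVlt => /predU1P[->//|xy].
  have := natpar_monotone (inspace _ Dx) (inspace _ Dy).
  by rewrite nmulr_rge0 ?subr_lt0// subr_le0.
exists `|natpar nu mu_max - natpar nu mu_min| => [//|m m1 m2 Dm Dm1 Dm2 toward].
set C := `|_|.
have C12 : `|natpar nu m2 - natpar nu m1| <= C.
  have /andP[m1a m1b] := Dm1; have /andP[m2a m2b] := Dm2.
  have mm : mu_min <= mu_max by exact: le_trans m1b.
  have Dmin : mu_min <= mu_min <= mu_max by rewrite lexx.
  have Dmax : mu_min <= mu_max <= mu_max by rewrite lexx andbT.
  have := mono _ _ Dmin Dm1 m1a; have := mono _ _ Dm1 Dmax m1b.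
  have := mono _ _ Dmin Dm2 m2a; have := mono _ _ Dm2 Dmax m2b.
  by rewrite /C => ? ? ? ?; rewrite (@ger0_norm _ (natpar nu mu_max - _)) ?ler_norml; lra.
have step1 : 0 <= (m - m1) * (natpar nu m2 - natpar nu m1).
  have [e|ne] := eqVneq m2 m1; first by rewrite e subrr mulr0.
  have [e|ne2] := eqVneq m m1; first by rewrite e subrr mul0r.
  move: toward; have [l|l|l] := ltgtP m1 m2; last by rewrite l eqxx in ne.
    rewrite pmulr_lge0 ?subr_gt0// => ?; apply: mulr_ge0 => //.
    by rewrite subr_ge0 mono// ltW.
  rewrite nmulr_lge0 ?subr_lt0// => ?; apply: mulr_le0 => //.
  by rewrite subr_le0 mono// ltW.
(* Since [kld nu m2 m1] is nonnegative, [kld nu m1 m2] is at most the symmetrized divergence, a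
   product of increments of the mean and of the natural parameter. *)
have step2 : kld nu m1 m2 <= C * `|m2 - m1|.
  have := kld_ge0 (inspace _ Dm2) (inspace _ Dm1).
  have : (m2 - m1) * (natpar nu m2 - natpar nu m1) <= C * `|m2 - m1|.
    rewrite mulrC; apply: le_trans (ler_norm _) _.
    by rewrite normrM ler_wpM2r.
  by rewrite /kld /loglr => ? ?; lra.
have := kld_diff nu m m1 m2; lra.
Qed.

Lemma bernoulli_klE (R : realType) (delta : R) : 0 < delta -> delta <= 1 / 2 ->
  bernoulli_kl delta (1 - delta) =
  ((1 - 2 * delta) * ln ((1 - delta) / delta))%:E.
Proof.
move=> d0 d2; have d1 : 0 < 1 - delta by lra.
pose c := ln ((1 - delta) / delta).
have ce : expR c = (1 - delta) / delta by rewrite lnK// posrE divr_gt0.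
have cNe : expR (- c) = delta / (1 - delta) by rewrite expRN ce invf_div.
have c0 : 0 <= c by rewrite ln_ge0// ler_pdivlMr//; lra.
(* The log-density of Bernoulli [delta] against Bernoulli [1 - delta]. The sign of [c] tells which
   value is the positive part when the integral is split. *)
pose g (b : bool) : R := if b then - c else c.
have dI : 0 <= delta <= 1 by apply/andP; split; lra.
have dI' : 0 <= 1 - delta <= 1 by apply/andP; split; lra.
rewrite /bernoulli_kl (KL_density (g := g))//.
  rewrite integralE !integral_bernoulli_prob// /unstable.onem !funeposE !funenegE /g -!EFinN !opprK.
  rewrite -!EFin_max -!EFinM -!EFinD -?EFinB -/c; congr EFin.
  by rewrite !(max_l c0) !max_r ?oppr_le0//; ring.
move=> C _; rewrite integral_mkcond integral_bernoulli_prob//; last first.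
  by move=> x; apply: erestrict_ge0 => y _ /=; rewrite lee_fin expR_ge0.
apply: (etrans (bernoulli_probE dI C)); rewrite !epatch_indic/= /g cNe ce !diracE !indicE /unstable.onem.
rewrite -!EFinM -!EFinD; congr EFin.
by field; rewrite !gt_eqF.
Qed.

(** * Histories and rounds *)

(** Splitting along the arm played reduces measurability and integration of functions of a round to
    functions of the reward, one arm at a time. *)
Lemma ord_case_sum (T : Type) (R : realType) K (A : T -> 'I_K) (X : T -> R)
    (h : 'I_K -> R -> R) w :
  h (A w) (X w) = \sum_(a < K) \1_(A @^-1` [set a]) w * h a (X w).
Proof.
rewrite (bigD1 (A w))//= indicE mem_set// mul1r big1 ?addr0// => a aA.
by rewrite indicE memNset ?mul0r// => /= /eqP; rewrite eq_sym (negbTE aA).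
Qed.

Lemma measurable_ord_case d (T : measurableType d) (R : realType) K
    (A : T -> 'I_K) (X : T -> R) (h : 'I_K -> R -> R) :
  (forall a, measurable (A @^-1` [set a])) -> measurable_fun setT X ->
  (forall a, measurable_fun setT (h a)) ->
  measurable_fun setT (fun w => h (A w) (X w)).
Proof.
move=> mA mX mh; under eq_fun do rewrite ord_case_sum.
apply: measurable_sum => a; apply: measurable_funM; first exact: measurable_indic.
exact: measurableT_comp.
Qed.

Section history.
Context (R : realType) (K : nat) d (Omega : measurableType d)
  du (U : measurableType du) (L : learner R K Omega U).

Definition history_generator t : set_system Omega :=
  preimage_set_system setT (seed L) measurable `|`
  \bigcup_(s in [set s | (s < t)%N])
    (preimage_set_system setT (arm L s) setT `|`
     preimage_set_system setT (reward L s) measurable).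

(** [Omega] with the coarser sigma-algebra of the history, so that dependence on the past alone is
    expressed by [measurable_fun]. *)
Definition history_space t := g_sigma_algebraType (history_generator t).

Lemma history_arm t s (Y : set 'I_K) : (s < t)%N -> history L t (arm L s @^-1` Y).
Proof.
move=> st; apply: sub_sigma_algebra; right; exists s => //; left.
by exists Y => //; rewrite setTI.
Qed.

Lemma history_reward t s (C : set R) : (s < t)%N -> measurable C ->
  history L t (reward L s @^-1` C).
Proof.
move=> st mC; apply: sub_sigma_algebra; right; exists s => //; right.
by exists C => //; rewrite setTI.
Qed.

Lemma history_le s t E : (s <= t)%N -> history L s E -> history L t E.
Proof.
move=> st; apply: smallest_sub; first exact: smallest_sigma_algebra.
move=> D [?|[n /= ns ?]]; apply: sub_sigma_algebra; first by left.
by right; exists n => //=; exact: leq_trans st.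
Qed.

Lemma history_seed t V : measurable V -> history L t (seed L @^-1` V).
Proof.
move=> mV; apply: sub_sigma_algebra; left; exists V => //; exact: setTI.
Qed.

Lemma measurable_history_round t s (h : 'I_K -> R -> R) : (s < t)%N ->
  (forall a, measurable_fun setT (h a)) ->
  measurable_fun (setT : set (history_space t))
    (fun w => h (arm L s w) (reward L s w)).
Proof.
move=> st mh; apply: measurable_ord_case => //.
  by move=> a; exact: (history_arm _ st).
by move=> _ C mC; rewrite setTI; exact: (history_reward st).
Qed.

Context (Pi F : set 'cV[R]_K) (hL : admissible L Pi F).

Lemma measurable_arm t (Y : set 'I_K) : measurable (arm L t @^-1` Y).
Proof.
have -> : arm L t @^-1` Y = \bigcup_(a in Y) (arm L t @^-1` [set a]).
  by apply/seteqP; split => [w Yw|w [a Ya /= aw]]; [exists (arm L t w)|rewrite /= aw].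
by apply: fin_bigcup_measurable => // a _; exact: arm_measurable hL _ _.
Qed.

Lemma history_measurable t E : history L t E -> measurable E.
Proof.
move: E; apply: smallest_sub; first exact: sigma_algebra_measurable.
move=> _ [[V mV <-]|[s _ [[Y _ <-]|[C mC <-]]]]; rewrite setTI.
- by rewrite -[X in measurable X]setTI; apply: (seed_measurable hL).
- exact: measurable_arm.
- by rewrite -[X in measurable X]setTI; apply: (reward_measurable hL).
Qed.

Lemma history_fun_measurable t (f : Omega -> R) :
  measurable_fun (setT : set (history_space t)) f -> measurable_fun setT f.
Proof.
move=> mf _ Y mY; have := mf measurableT Y mY; rewrite !setTI.
exact: history_measurable.
Qed.

Lemma measurable_history_id t :
  measurable_fun setT (id : Omega -> history_space t).
Proof. by move=> _ E mE; rewrite setTI; exact: (history_measurable mE). Qed.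

Lemma measurable_explore t a :
  measurable_fun (setT : set (history_space t)) (fun w => explore L t w a ord0).
Proof. by move=> _ C mC; rewrite setTI; exact: (explore_predictable hL). Qed.

Hypothesis Pi_simplex : Pi `<=` @simplex R K.

Lemma explore_ge0 t w a : 0 <= explore L t w a ord0.
Proof. by have [+ _] := Pi_simplex (explore_feasible hL t w); exact. Qed.

Lemma explore_le1 t w a : explore L t w a ord0 <= 1.
Proof. by apply: simplex_le1; apply: Pi_simplex; exact: (explore_feasible hL). Qed.

Context (nu : exp_family R) (l : 'cV[R]_K) (P : probability Omega R)
  (hP : bandit_law L nu l P).

Lemma integrable_explore t a E : measurable E ->
  P.-integrable E (fun w => (explore L t w a ord0)%:E).
Proof.
move=> mE; apply: (@le_integrable _ _ _ _ _ _ _ (cst 1%E)) => //.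
- by apply/measurable_EFinP/measurable_funTS/history_fun_measurable; exact: measurable_explore.
- by move=> w _ /=; rewrite lee_fin normr1 ger0_norm ?explore_ge0// explore_le1.
- exact: finite_measure_integrable_cst.
Qed.

(** [round_distribution] is the case where [g] is an indicator; [ge0_integral_transfer] along the
    reward extends it to nonnegative [g]. *)
Lemma ge0_round_integral_set t (E : set Omega) a (g : R -> R) : history L t E ->
  measurable_fun setT g -> (forall x, 0 <= g x) ->
  (\int[P]_w (g (reward L t w) * \1_(E `&` arm L t @^-1` [set a]) w)%:E =
   \int[P]_(w in E) (explore L t w a ord0)%:E * \int[nu (l a ord0)]_x (g x)%:E)%E.
Proof.
move=> hE mg g0; have mE := history_measurable hE.
have fink : (\int[P]_(w in E) (explore L t w a ord0)%:E \is a fin_num)%E.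
  exact: integrable_fin_num (integrable_explore t a mE).
set k := (\int[P]_(w in E) _)%E in fink *.
have k0 : (0 <= k)%E by apply: integral_ge0 => w _; rewrite lee_fin explore_ge0.
transitivity (\int[nu (l a ord0)]_x (g x * fine k)%:E)%E.
  apply: (ge0_integral_transfer (psi := id)) => //.
  - exact: (reward_measurable hL).
  - apply: measurable_indic; apply: measurableI => //; exact: measurable_arm.
  - by move=> x; exact: fine_ge0.
  move=> C mC; rewrite integral_cst// -(preimage_id C).
  rewrite integral_indic//; last 2 first.
  - by rewrite -[X in measurable X]setTI; apply: (reward_measurable hL).
  - by apply: measurableI => //; exact: measurable_arm.
  by rewrite preimage_id fineK//; exact: (round_distribution hP hE a mC).
under eq_integral do rewrite EFinM muleC.
rewrite ge0_integralZl_EFin ?fine_ge0 ?fineK//.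
- by move=> x _; rewrite lee_fin.
- exact/measurable_EFinP.
Qed.

(** A second transfer, now along the identity into [history_space t], replaces the event of the past
    by a nonnegative function [f] of the past. *)
Lemma ge0_round_integral_arm t (f : Omega -> R) a (g : R -> R) :
  measurable_fun (setT : set (history_space t)) f -> (forall w, 0 <= f w) ->
  measurable_fun setT g -> (forall x, 0 <= g x) ->
  (\int[nu (l a ord0)]_x (g x)%:E < +oo)%E ->
  (\int[P]_w (f w * (\1_(arm L t @^-1` [set a]) w * g (reward L t w)))%:E =
   \int[P]_w (f w * explore L t w a ord0)%:E * \int[nu (l a ord0)]_x (g x)%:E)%E.
Proof.
move=> mf f0 mg g0 goo.
have gI0 : (0 <= \int[nu (l a ord0)]_x (g x)%:E)%E.
  by apply: integral_ge0 => x _; rewrite lee_fin.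
have gfin : (\int[nu (l a ord0)]_x (g x)%:E)%E \is a fin_num by rewrite ge0_fin_numE.
set c := (\int[nu (l a ord0)]_x _)%E in gI0 goo gfin *.
have mpi : measurable_fun setT (fun w => explore L t w a ord0).
  by apply: history_fun_measurable; exact: measurable_explore.
have mf' := history_fun_measurable mf.
have mX : measurable_fun setT (reward L t) by exact: (reward_measurable hL).
have mgX : measurable_fun setT (fun w => g (reward L t w)) by exact: measurableT_comp.
have m1 : measurable_fun setT (\1_(arm L t @^-1` [set a]) : Omega -> R).
  by apply: measurable_indic; exact: measurable_arm.
transitivity (\int[P]_w (f w * (fine c * explore L t w a ord0))%:E)%E.
  apply: (@ge0_integral_transfer _ _ _ _ _ (history_space t) _ P P id id
    (fun w => \1_(arm L t @^-1` [set a]) w * g (reward L t w))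
    (fun w => fine c * explore L t w a ord0) f) => //.
  - exact: measurable_history_id.
  - exact: measurable_history_id.
  - exact: measurable_funM.
  - by apply: measurable_funM.
  - by move=> w; rewrite mulr_ge0.
  - by move=> w; rewrite mulr_ge0 ?fine_ge0 ?explore_ge0.
  move=> E hE; have mE := history_measurable hE; rewrite preimage_id.
  transitivity (\int[P]_w (g (reward L t w) *
      \1_(E `&` arm L t @^-1` [set a]) w)%:E)%E.
    rewrite integral_indicr; apply: eq_integral => w _; congr EFin.
    by rewrite indicI /=; ring.
  rewrite ge0_round_integral_set// -/c.
  under [RHS]eq_integral do rewrite EFinM.
  rewrite ge0_integralZl_EFin ?fine_ge0 ?fineK//.
  - by rewrite muleC.
  - by move=> w _; rewrite lee_fin explore_ge0.
  - by apply/measurable_EFinP; exact: measurable_funTS.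
under eq_integral do rewrite mulrCA EFinM.
rewrite ge0_integralZl_EFin ?fine_ge0 ?fineK//.
- by rewrite muleC.
- by move=> w _; rewrite lee_fin mulr_ge0 ?explore_ge0.
- by apply/measurable_EFinP; exact: measurable_funM.
Qed.

Lemma ge0_round_integral t (f : Omega -> R) (h : 'I_K -> R -> R) :
  measurable_fun (setT : set (history_space t)) f -> (forall w, 0 <= f w) ->
  (forall a, measurable_fun setT (h a)) -> (forall a x, 0 <= h a x) ->
  (forall a, \int[nu (l a ord0)]_x (h a x)%:E < +oo)%E ->
  (\int[P]_w (f w * h (arm L t w) (reward L t w))%:E =
   \sum_(a < K) \int[P]_w (f w * explore L t w a ord0)%:E *
                \int[nu (l a ord0)]_x (h a x)%:E)%E.
Proof.
move=> mf f0 mh h0 hoo.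
under eq_integral do rewrite ord_case_sum mulr_sumr -sumEFin.
rewrite ge0_integral_sum//.
- by apply: eq_bigr => a _; exact: ge0_round_integral_arm.
- move=> a; apply/measurable_EFinP; apply: measurable_funM.
    exact: history_fun_measurable mf.
  apply: measurable_funM; first by apply: measurable_indic; exact: measurable_arm.
  by apply: measurableT_comp => //; exact: (reward_measurable hL).
- by move=> a w _; rewrite lee_fin !mulr_ge0.
Qed.

Lemma round_integral_set t (E : set Omega) a (g : R -> R) : history L t E ->
  (nu (l a ord0)).-integrable setT (EFin \o g) ->
  P.-integrable setT (fun w => (g (reward L t w) * \1_(E `&` arm L t @^-1` [set a]) w)%:E) /\
  (\int[P]_w (g (reward L t w) * \1_(E `&` arm L t @^-1` [set a]) w)%:E =
   \int[P]_(w in E) (explore L t w a ord0)%:E * \int[nu (l a ord0)]_x (g x)%:E)%E.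
Proof.
move=> hE ig.
have mg : measurable_fun setT g by apply/measurable_EFinP; exact: measurable_int ig.
have mE := history_measurable hE.
have fink : (\int[P]_(w in E) (explore L t w a ord0)%:E \is a fin_num)%E.
  exact: integrable_fin_num (integrable_explore t a mE).
have ign : (nu (l a ord0)).-integrable setT (fun x => (`|g x|)%:E).
  exact: integrable_norm ig.
set B := E `&` _.
have mB : measurable B by apply: measurableI => //; exact: measurable_arm.
have integ g' : (nu (l a ord0)).-integrable setT (EFin \o g') ->
    P.-integrable setT (fun w => (g' (reward L t w) * \1_B w)%:E).
  move=> ig'; have mg' : measurable_fun setT g' by apply/measurable_EFinP; exact: measurable_int ig'.
  apply/integrableP; split.
    apply/measurable_EFinP; apply: measurable_funM; last exact: measurable_indic.
    by apply: measurableT_comp => //; exact: (reward_measurable hL).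
  under eq_integral do rewrite /= normrM (@ger0_norm _ (\1_B _))//.
  rewrite (@ge0_round_integral_set t E a (fun x => `|g' x|))//; last exact: measurableT_comp.
  apply: lte_mul_pinfty => //; first by apply: integral_ge0 => w _; rewrite lee_fin explore_ge0.
  by have /integrableP[_] := ig'.
have ig2 : (nu (l a ord0)).-integrable setT (EFin \o (fun x => g x + `|g x|)).
  exact: (integrableD measurableT ig ign).
split; first exact: integ.
(* A signed [g] is the difference of the nonnegative functions [g + |g|] and [|g|]. *)
have -> : (\int[P]_w (g (reward L t w) * \1_B w)%:E =
   \int[P]_w ((g (reward L t w) + `|g (reward L t w)|) * \1_B w)%:E -
   \int[P]_w (`|g (reward L t w)| * \1_B w)%:E)%E.
  rewrite -integralB//; [|exact: (integ (fun x => g x + `|g x|))|exact: (integ (fun x => `|g x|))].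
  by apply: eq_integral => w _; rewrite -EFinB; congr EFin; ring.
have mng : measurable_fun setT (fun x => `|g x|) by exact: measurableT_comp.
rewrite (@ge0_round_integral_set t E a (fun x => g x + `|g x|))//; last 2 first.
- exact: measurable_funD.
- by move=> x; rewrite -lerBlDl sub0r ler_normr lexx orbT.
rewrite (@ge0_round_integral_set t E a (fun x => `|g x|))//.
have -> : (\int[nu (l a ord0)]_x (g x + `|g x|)%:E =
    \int[nu (l a ord0)]_x (g x)%:E + \int[nu (l a ord0)]_x (`|g x|)%:E)%E.
  exact: (integralD measurableT ig ign).
rewrite muleDr//; last first.
  by apply: fin_num_adde_defl; exact: integrable_fin_num ign.
rewrite addeK// fin_numM//; exact: integrable_fin_num ign.
Qed.

End history.

(** * Change of measure *)

Section change_of_measure.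
Context (R : realType) (K : nat) d (Omega : measurableType d)
  du (U : measurableType du) (L : learner R K Omega U)
  (Pi F : set 'cV[R]_K) (hL : admissible L Pi F)
  (Pi_simplex : Pi `<=` @simplex R K)
  (nu : exp_family R) (l0 l1 : 'cV[R]_K)
  (ms0 : forall a, mean_space nu (l0 a ord0))
  (ms1 : forall a, mean_space nu (l1 a ord0))
  (P0 P1 : probability Omega R)
  (hP0 : bandit_law L nu l0 P0) (hP1 : bandit_law L nu l1 P1).

(* The density of the reward of arm a under l1 with respect to the one under l0. *)
Definition arm_ratio (a : 'I_K) (x : R) :=
  expR (loglr nu (l1 a ord0) (l0 a ord0) x).

Definition round_ratio s w := arm_ratio (arm L s w) (reward L s w).

(** The likelihood ratio of [l1] to [l0] over the first [t] rounds: the law of the seed and the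
    exploration probabilities are common to both instances and cancel. *)
Definition history_ratio t w := \prod_(s < t) round_ratio s w.

Lemma arm_ratio_ge0 a x : 0 <= arm_ratio a x.
Proof. exact: expR_ge0. Qed.

Lemma measurable_arm_ratio a : measurable_fun setT (arm_ratio a).
Proof. by apply: measurableT_comp => //; exact: measurable_loglr. Qed.

Lemma measurable_round_ratio t s : (s < t)%N ->
  measurable_fun (setT : set (history_space L t)) (round_ratio s).
Proof.
by move=> st; apply: measurable_history_round => // a; exact: measurable_arm_ratio.
Qed.

Lemma measurable_history_ratio t :
  measurable_fun (setT : set (history_space L t)) (history_ratio t).
Proof.
by apply: measurable_prod => s _; apply: measurable_round_ratio.
Qed.

Lemma history_ratio_ge0 t w : 0 <= history_ratio t w.
Proof. by apply: prodr_ge0 => s _; exact: arm_ratio_ge0. Qed.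

Lemma integral_arm_ratio a (h : R -> R) :
  measurable_fun setT h -> (forall x, 0 <= h x) ->
  (\int[nu (l0 a ord0)]_x (h x * arm_ratio a x)%:E =
   \int[nu (l1 a ord0)]_x (h x)%:E)%E.
Proof.
move=> mh h0; apply/esym/ge0_integral_density => //.
- exact: measurable_arm_ratio.
- by move=> x; exact: arm_ratio_ge0.
- by move=> C mC; exact: family_loglr.
Qed.

Lemma change_of_measure_fun t (f : Omega -> R) :
  (forall E, history L t E -> P1 E = \int[P0]_(w in E) (history_ratio t w)%:E)%E ->
  measurable_fun (setT : set (history_space L t)) f -> (forall w, 0 <= f w) ->
  (\int[P1]_w (f w)%:E = \int[P0]_w (f w * history_ratio t w)%:E)%E.
Proof.
move=> PE mf f0; under eq_integral do rewrite -[f _]mulr1.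
apply: (@ge0_integral_transfer _ _ _ _ _ (history_space L t) _ P1 P0 id id
    (fun w => 1) (history_ratio t) f) => //.
- exact: (measurable_history_id hL).
- exact: (measurable_history_id hL).
- exact: (history_fun_measurable hL (measurable_history_ratio (t:=t))).
- by move=> w; exact: history_ratio_ge0.
move=> E hE; rewrite preimage_id -PE// integral_cst ?mul1e//.
exact: (history_measurable hL hE).
Qed.

(** Before any round the history is generated by the seed alone, whose law does not depend on the
    instance. *)
Lemma change_of_measure0 E : history L 0 E ->
  P1 E = (\int[P0]_(w in E) (history_ratio 0 w)%:E)%E.
Proof.
move=> hE; have [V mV <-] : preimage_set_system setT (seed L) measurable E.
  move: E hE; apply: smallest_sub.
    exact/sigma_algebra_preimage/sigma_algebra_measurable.
  by move=> D [//|[]].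
rewrite setTI (seed_distribution hP1)//.
under eq_integral do rewrite /history_ratio big_ord0.
rewrite integral_cst ?mul1e.
  by apply/esym; exact: (seed_distribution hP0).
by rewrite -[X in measurable X]setTI; apply: (seed_measurable hL).
Qed.

(** Induction step of [change_of_measure]: [ge0_round_integral] separates round [t] from its past
    under both laws; the past changes measure by the induction hypothesis and the reward by
    [integral_arm_ratio]. *)
Lemma change_of_measure_rectangle t E (Y : set 'I_K) (C : set R) :
  (forall E, history L t E -> P1 E = \int[P0]_(w in E) (history_ratio t w)%:E)%E ->
  history L t E -> measurable C ->
  P1 (E `&` arm L t @^-1` Y `&` reward L t @^-1` C) =
  (\int[P0]_(w in E `&` arm L t @^-1` Y `&` reward L t @^-1` C)
     (history_ratio t.+1 w)%:E)%E.
Proof.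
move=> IH hE mC.
have mE := history_measurable hL hE.
have mY := measurable_arm hL t Y.
have mXC : measurable (reward L t @^-1` C).
  by rewrite -[X in measurable X]setTI; apply: (reward_measurable hL).
set B := _ `&` _ `&` _.
have mB : measurable B by apply: measurableI => //; exact: measurableI.
pose h (a : 'I_K) x : R := \1_Y a * \1_C x.
have h0 a x : 0 <= h a x by rewrite mulr_ge0.
have mh a : measurable_fun setT (h a).
  by apply: measurable_funM => //; exact: measurable_indic.
have h1 a x : h a x <= 1 by rewrite mulr_ile1.
have hoo a : (\int[nu (l1 a ord0)]_x (h a x)%:E < +oo)%E.
  apply: (@le_lt_trans _ _ (\int[nu (l1 a ord0)]_x (cst 1 x))%E).
    apply: ge0_le_integral => //.
    - by move=> x _; rewrite lee_fin.
    - exact/measurable_EFinP.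
    - by move=> x _; rewrite /= lee_fin h1.
  by rewrite integral_cst// mul1e -ge0_fin_numE// fin_num_measure.
have Bh w : \1_B w = \1_E w * h (arm L t w) (reward L t w) :> R.
  by rewrite /B !indicI /= /h mulrA.
have mIE : measurable_fun (setT : set (history_space L t)) (\1_E : Omega -> R).
  by apply: measurable_indic; exact: hE.
transitivity (\int[P1]_w (\1_E w * h (arm L t w) (reward L t w))%:E)%E.
  under eq_integral do rewrite -Bh.
  by rewrite integral_indic// setIT.
rewrite (ge0_round_integral hL Pi_simplex hP1)//.
rewrite integral_indicr.
transitivity (\int[P0]_w ((\1_E w * history_ratio t w) *
   (fun a x => h a x * arm_ratio a x) (arm L t w) (reward L t w))%:E)%E; last first.
  apply: eq_integral => w _; rewrite Bh /history_ratio big_ord_recr/=.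
  by rewrite /round_ratio; congr EFin; ring.
rewrite (ge0_round_integral hL Pi_simplex hP0 (f := fun w => \1_E w * history_ratio t w)
  (h := fun a x => h a x * arm_ratio a x))//.
- apply: eq_bigr => a _; rewrite integral_arm_ratio//; congr (_ * _)%E.
  rewrite (change_of_measure_fun IH).
  + by apply: eq_integral => w _; congr EFin; ring.
  + by apply: measurable_funM => //; exact: (measurable_explore hL).
  + by move=> w; rewrite mulr_ge0// (explore_ge0 hL Pi_simplex).
- apply: measurable_funM => //; exact: measurable_history_ratio.
- by move=> w; rewrite mulr_ge0// history_ratio_ge0.
- by move=> a; apply: measurable_funM => //; exact: measurable_arm_ratio.
- by move=> a x; rewrite mulr_ge0// arm_ratio_ge0.
- by move=> a; rewrite integral_arm_ratio.
Qed.

(** Induction on the number of rounds. Both sides are finite measures in [E], so agreement on the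
    events that factor into the past, the last arm and the last reward is enough. *)
Lemma change_of_measure t E : history L t E ->
  P1 E = (\int[P0]_(w in E) (history_ratio t w)%:E)%E.
Proof.
elim: t E => [|t IH] E; first exact: change_of_measure0.
(* The events of G form a pi-system that generates the next history. *)
pose G : set_system Omega := [set B | exists E' (Y : set 'I_K) (C : set R),
  [/\ history L t E', measurable C &
      B = E' `&` arm L t @^-1` Y `&` reward L t @^-1` C]].
have GI : setI_closed G.
  move=> _ _ [E1 [Y1 [C1 [hE1 mC1 ->]]]] [E2 [Y2 [C2 [hE2 mC2 ->]]]].
  exists (E1 `&` E2), (Y1 `&` Y2), (C1 `&` C2); split.
  - exact: (@measurableI _ (history_space L t)).
  - exact: measurableI.
  - by apply/seteqP; split => w /=; tauto.
have Gm : G `<=` measurable.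
  move=> _ [E1 [Y1 [C1 [hE1 mC1 ->]]]]; apply: measurableI.
    by apply: measurableI; [exact: (history_measurable hL hE1)|exact: (measurable_arm hL)].
  by rewrite -[X in measurable X]setTI; apply: (reward_measurable hL).
have sGm : <<s G >> `<=` measurable.
  by apply: smallest_sub => //; exact: sigma_algebra_measurable.
have GT : G setT.
  exists setT, setT, setT; split => //; last by rewrite !preimage_setT !setIT.
  exact: (@measurableT _ (history_space L t)).
have hG : history L t.+1 `<=` <<s G >>.
  apply: smallest_sub; first exact: smallest_sigma_algebra.
  move=> _ [[V mV <-]|[s /= st [[Y _ <-]|[C mC <-]]]]; rewrite setTI; apply: sub_sigma_algebra.
  - exists (seed L @^-1` V), setT, setT; split => //; last by rewrite !preimage_setT !setIT.
    exact: history_seed.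
  - move: st; rewrite ltnS leq_eqVlt => /predU1P[->|st].
      exists setT, Y, setT; split => //; last by rewrite preimage_setT setIT setTI.
      exact: (@measurableT _ (history_space L t)).
    exists (arm L s @^-1` Y), setT, setT; split => //; last by rewrite !preimage_setT !setIT.
    exact: history_arm.
  - move: st; rewrite ltnS leq_eqVlt => /predU1P[->|st].
      exists setT, setT, C; split => //; last by rewrite preimage_setT !setTI.
      exact: (@measurableT _ (history_space L t)).
    exists (reward L s @^-1` C), setT, setT; split => //; last by rewrite !preimage_setT !setIT.
    exact: history_reward.
have mW : measurable_fun setT (fun w => (history_ratio t.+1 w)%:E).
  apply/measurable_EFinP; exact: (history_fun_measurable hL (measurable_history_ratio (t:=t.+1))).
have W0 w : (0 <= (history_ratio t.+1 w)%:E)%E by rewrite lee_fin history_ratio_ge0.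
have onG B : G B -> P1 B = (\int[P0]_(w in B) (history_ratio t.+1 w)%:E)%E.
  by move=> [E1 [Y1 [C1 [hE1 mC1 ->]]]]; exact: change_of_measure_rectangle.
move=> /hG; apply: (@dynkin_induction _ (g_sigma_algebraType G) G
  (fun B => P1 B = (\int[P0]_(w in B) (history_ratio t.+1 w)%:E)%E)) => //.
- exact: onG.
- move=> S /sGm mS PS; have mSC : measurable (~` S : set Omega) by exact: measurableC.
  have := onG _ GT; rewrite -(setUv S) measureU//; last by rewrite setICr.
  rewrite ge0_integral_setU//; last 2 first.
  + exact: measurable_funTS.
  + by apply/disj_setPS; rewrite setICr.
  rewrite -PS => /(congr1 (fun z => z - P1 S)%E).
  by rewrite ![(P1 S + _)%E]addeC !addeK// fin_num_measure.
- move=> A mA tA PA; rewrite measure_bigcup//.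
    rewrite ge0_integral_bigcup//.
    - apply/congr_lim/funext => n; apply: eq_big => [i|i _]; last exact: PA.
      by rewrite in_setT.
    - by move=> i; exact: (sGm _ (mA i)).
    - exact: measurable_funTS.
  by move=> i _; exact: (sGm _ (mA i)).
Qed.

End change_of_measure.

(** * The stopped log-likelihood ratio and its expectation *)

Section information.
Context (R : realType) (K : nat) d (Omega : measurableType d)
  du (U : measurableType du) (L : learner R K Omega U)
  (Pi F : set 'cV[R]_K) (hL : admissible L Pi F)
  (Pi_simplex : Pi `<=` @simplex R K).

Lemma stopped_by_le s t : (s <= t)%N -> stopped_by L s `<=` stopped_by L t.
Proof. by move=> st w [n sn ns]; exists n => //; exact: leq_trans st. Qed.

Lemma history_running t : history L t (~` stopped_by L t).
Proof.
apply: (@measurableC _ (history_space L t)); exact: (stop_stopping_time hL).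
Qed.

(** Expected number of pulls before stopping, within the horizon. Round [s], counted from 0, is
    played exactly when the learner has not stopped by [s]. Integrating the exploration policy
    instead of the indicator of the pull makes linear constraints pass to the sum. *)
Definition pulls (P : probability Omega R) t (a : 'I_K) : R :=
  \sum_(s < t) fine (\int[P]_(w in ~` stopped_by L s) (explore L s w a ord0)%:E)%E.

Context (nu : exp_family R) (l0 l1 : 'cV[R]_K)
  (ms0 : forall a, mean_space nu (l0 a ord0))
  (ms1 : forall a, mean_space nu (l1 a ord0))
  (P0 P1 : probability Omega R)
  (hP0 : bandit_law L nu l0 P0) (hP1 : bandit_law L nu l1 P1).

Definition stopped_ratio t w :=
  \prod_(s < t) (if `[< stopped_by L s w >] then 1 else round_ratio L nu l0 l1 s w).

(** The log-likelihood ratio of [l0] against [l1], opposite in direction to [stopped_ratio]. It is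
    split by arm so that each term falls under [round_integral_set]. *)
Definition stopped_llr t w := \sum_(s < t) \sum_(a < K)
  loglr nu (l0 a ord0) (l1 a ord0) (reward L s w) *
  \1_(~` stopped_by L s `&` arm L s @^-1` [set a]) w.

Lemma stopped_ratioE t w : stopped_ratio t w = expR (- stopped_llr t w).
Proof.
rewrite /stopped_ratio /stopped_llr -sumrN expR_sum; apply: eq_bigr => s _.
transitivity (expR (- (\1_(~` stopped_by L s) w *
    loglr nu (l0 (arm L s w) ord0) (l1 (arm L s w) ord0) (reward L s w)))).
  case: asboolP => sw.
    by rewrite indicE memNset ?mul0r ?oppr0 ?expR0//= => /(_ sw).
  rewrite indicE mem_set// mul1r /round_ratio /arm_ratio; congr expR.
  by rewrite /loglr; ring.
rewrite (ord_case_sum (fun w => arm L s w) (fun w => reward L s w)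
  (fun a x => loglr nu (l0 a ord0) (l1 a ord0) x)) mulr_sumr; congr (expR (- _)).
by apply: eq_bigr => a _; rewrite indicI /=; ring.
Qed.

Lemma stopped_ratio_running t w : ~ stopped_by L t w ->
  stopped_ratio t w = history_ratio L nu l0 l1 t w.
Proof.
move=> tw; apply: eq_bigr => s _; case: asboolP => // sw.
by exfalso; apply: tw; apply: stopped_by_le sw; exact: ltnW.
Qed.

Lemma stopped_ratioS_stopped t w : stopped_by L t w ->
  stopped_ratio t.+1 w = stopped_ratio t w.
Proof. by move=> tw; rewrite /stopped_ratio big_ord_recr/= asboolT// mulr1. Qed.

Lemma stopped_ratioS_running t w : ~ stopped_by L t w ->
  stopped_ratio t.+1 w = history_ratio L nu l0 l1 t.+1 w.
Proof.
move=> tw; rewrite /stopped_ratio /history_ratio !big_ord_recr/= asboolF//.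
by congr (_ * _); exact: stopped_ratio_running.
Qed.

Lemma measurable_stopped_llr t : measurable_fun setT (stopped_llr t).
Proof.
apply: measurable_sum => s; apply: measurable_sum => a.
apply: measurable_funM; first by apply: measurableT_comp; [exact: measurable_loglr|exact: (reward_measurable hL)].
apply: measurable_indic; apply: measurableI; last exact: (measurable_arm hL).
exact: (history_measurable hL (@history_running s)).
Qed.

Lemma measurable_stopped_ratio t : measurable_fun setT (stopped_ratio t).
Proof.
have -> : stopped_ratio t = fun w => expR (- stopped_llr t w).
  by apply/funext => w; exact: stopped_ratioE.
by apply: measurableT_comp => //; apply: measurableT_comp => //; exact: measurable_stopped_llr.
Qed.

Lemma running_change_of_measure t : P1 (~` stopped_by L t) =
  (\int[P0]_(w in ~` stopped_by L t) (stopped_ratio t w)%:E)%E.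
Proof.
rewrite (change_of_measure hL Pi_simplex ms0 ms1 hP0 hP1 (@history_running t)).
by apply: eq_integral => w; rewrite inE => tw; rewrite stopped_ratio_running.
Qed.

(** Induction on [t]: on the part already stopped by [t] the new factor is 1, and on the part that
    stops at [t.+1] the stopped ratio is the full history ratio. *)
Lemma stopped_change_of_measure (E : set Omega) t :
  (forall s, history L s (E `&` stopped_by L s)) ->
  P1 (E `&` stopped_by L t) =
  (\int[P0]_(w in E `&` stopped_by L t) (stopped_ratio t w)%:E)%E.
Proof.
move=> hE; elim: t => [|t IH].
  rewrite (change_of_measure hL Pi_simplex ms0 ms1 hP0 hP1 (hE 0%N)).
  by apply: eq_integral => w _; rewrite /history_ratio /stopped_ratio !big_ord0.
have EE : E `&` stopped_by L t.+1 =
    (E `&` stopped_by L t) `|` (E `&` stopped_by L t.+1 `&` ~` stopped_by L t).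
  apply/seteqP; split => w.
    by move=> [Ew tw]; have [st|st] := pselect (stopped_by L t w); [left|right].
  move=> [[Ew tw]|[//]]; split => //; exact: stopped_by_le tw.
have hD : history L t.+1 (E `&` stopped_by L t.+1 `&` ~` stopped_by L t).
  apply: (@measurableI _ (history_space L t.+1)); first exact: hE.
  exact: history_le (@history_running t).
have mE := history_measurable hL (hE t).
have mD := history_measurable hL hD.
have disj : [disjoint E `&` stopped_by L t & E `&` stopped_by L t.+1 `&` ~` stopped_by L t].
  by apply/disj_setPS => w [[_ tw] [_]].
rewrite EE measureU//; last exact/eqP.
rewrite ge0_integral_setU//; last 2 first.
- by apply/measurable_EFinP/measurable_funTS; exact: measurable_stopped_ratio.
- by move=> w _; rewrite lee_fin stopped_ratioE expR_ge0.
congr (_ + _)%E.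
  by apply: (etrans IH); apply: eq_integral => w; rewrite inE => -[_ tw]; rewrite stopped_ratioS_stopped.
apply: (etrans (change_of_measure hL Pi_simplex ms0 ms1 hP0 hP1 hD)).
by apply: eq_integral => w; rewrite inE => -[_ tw]; rewrite stopped_ratioS_running.
Qed.

(** A Wald identity: still running at [s] is an event of the history before round [s], so each term
    integrates to an expected exploration weight times a divergence. *)
Lemma stopped_llr_integral t :
  P0.-integrable setT (fun w => (stopped_llr t w)%:E) /\
  (\int[P0]_w (stopped_llr t w)%:E =
   (\sum_(a < K) pulls P0 t a * kld nu (l0 a ord0) (l1 a ord0))%:E)%E.
Proof.
have step (s : nat) a := round_integral_set hL Pi_simplex hP0
  (@history_running s) (integrable_loglr (ms0 a) (l0 a ord0) (l1 a ord0)).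
have Z (s : 'I_t) a := (step s a).1; have V (s : 'I_t) a := (step s a).2.
have I2 (s : 'I_t) : P0.-integrable setT (fun w => (\sum_(a < K)
    (loglr nu (l0 a ord0) (l1 a ord0) (reward L s w) *
      \1_(~` stopped_by L s `&` arm L s @^-1` [set a]) w)%:E)%E).
  by apply: integrable_sum => // a _; exact: Z.
have E w : (stopped_llr t w)%:E = (\sum_(s < t) \sum_(a < K)
    (loglr nu (l0 a ord0) (l1 a ord0) (reward L s w) *
      \1_(~` stopped_by L s `&` arm L s @^-1` [set a]) w)%:E)%E.
  by rewrite /stopped_llr -sumEFin; apply: eq_bigr => s _; rewrite sumEFin.
split.
  by under eq_fun do rewrite E; apply: integrable_sum.
under eq_integral do rewrite E.
rewrite integral_sum//.
transitivity (\sum_(s < t) \sum_(a < K)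
  (fine (\int[P0]_(w in ~` stopped_by L s) (explore L s w a ord0)%:E)%E *
     kld nu (l0 a ord0) (l1 a ord0))%:E)%E.
  apply: eq_bigr => s _; rewrite integral_sum//; apply: eq_bigr => a _.
  rewrite V integral_loglr// EFinM fineK//.
  have mS := history_measurable hL (@history_running s).
  exact: integrable_fin_num (integrable_explore hL Pi_simplex P0 s a mS).
rewrite exchange_big/= -sumEFin; apply: eq_bigr => a _.
by rewrite /pulls mulr_suml sumEFin.
Qed.

(* The tangent to exp at +c bounds the log-likelihood ratio from below on H,
   and the tangent at -c does outside H. *)
Lemma information_lower_bound (H : set Omega) t (c y : R) :
  (forall s, history L s (H `&` stopped_by L s)) -> 0 <= c ->
  expR c * y + expR (- c) * (1 - y) = 1 ->
  (P1 (H `&` stopped_by L t) <= y%:E)%E ->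
  c * (2 * fine (P0 (H `&` stopped_by L t)) - 1) <=
  \sum_(a < K) pulls P0 t a * kld nu (l0 a ord0) (l1 a ord0).
Proof.
move=> hH c0 cy Hy.
set B := H `&` _ in Hy *.
have mB : measurable B := history_measurable hL (hH t).
have hHC s : history L s (~` H `&` stopped_by L s).
  have -> : ~` H `&` stopped_by L s = stopped_by L s `\` (H `&` stopped_by L s).
    by apply/seteqP; split => w /=; tauto.
  by apply: (@measurableD _ (history_space L s)); [exact: (stop_stopping_time hL)|exact: hH].
pose Z := stopped_ratio t.
have mZ : measurable_fun setT Z := measurable_stopped_ratio t.
have Z0 w : 0 <= Z w by rewrite /Z stopped_ratioE expR_ge0.
have PB : P1 B = (\int[P0]_w (Z w * \1_B w)%:E)%E.
  by rewrite -integral_indicr; exact: stopped_change_of_measure.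
(* The space splits into stopped inside [H], stopped outside [H] and still running; the change of
   measure holds on each piece. *)
have PT : (\int[P0]_w (Z w)%:E = 1)%E.
  rewrite -(probability_setT P1); have -> : [set: Omega] = (B `|` (~` H `&` stopped_by L t)) `|` ~` stopped_by L t.
    apply/seteqP; split => w // _ /=.
    have [tw|tw] := pselect (stopped_by L t w); last by right.
    by left; have [Hw|Hw] := pselect (H w); [left|right].
  have mB2 := history_measurable hL (hHC t).
  have mC := history_measurable hL (@history_running t).
  have d1 : [disjoint B & ~` H `&` stopped_by L t].
    by apply/disj_setPS => w [[Hw _] [Hw' _]].
  have d2 : [disjoint B `|` (~` H `&` stopped_by L t) & ~` stopped_by L t].
    by apply/disj_setPS => w [[[_ ?]|[_ ?]] ?].
  have mU : measurable (B `|` (~` H `&` stopped_by L t)) by exact: measurableU.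
  have mZE A : measurable_fun A (EFin \o Z) by apply/measurable_EFinP/measurable_funTS.
  rewrite measureU//; last exact/eqP.
  rewrite measureU//; last exact/eqP.
  rewrite ge0_integral_setU//; last by move=> w _; rewrite lee_fin.
  rewrite ge0_integral_setU//; last by move=> w _; rewrite lee_fin.
  congr (_ + _ + _)%E; apply/esym; first exact: stopped_change_of_measure.
    exact: stopped_change_of_measure.
  exact: running_change_of_measure.
have iZ : P0.-integrable setT (EFin \o Z).
  apply/integrableP; split; first exact/measurable_EFinP.
  by under eq_integral do rewrite /= ger0_norm//; rewrite PT ltry.
have i1 : P0.-integrable setT (fun w => (\1_B w)%:E).
  exact: integrable_indic.
have iZB : P0.-integrable setT (fun w => (Z w * \1_B w)%:E).
  apply/integrableP; split.
    by apply/measurable_EFinP; apply: measurable_funM.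
  under eq_integral do rewrite /= ger0_norm ?mulr_ge0//.
  by rewrite -PB -ge0_fin_numE// fin_num_measure.
have [illr llrE] := stopped_llr_integral t.
pose x := fine (P0 B); pose y' := fine (P1 B).
pose e1 := expR c - expR (- c); pose e2 := expR (- c).
(* This is [1 + c - expR c * Z w] on [B] and [1 - c - expR (- c) * Z w] outside it, the two tangent
   bounds in a single formula. *)
pose rhs w := ((1 - c) + 2 * c * \1_B w) - (e1 * (Z w * \1_B w) + e2 * Z w).
have i2 : P0.-integrable setT (fun w => ((1 - c)%:E + (2 * c)%:E * (\1_B w)%:E)%E).
  apply: integrableD => //; first exact: finite_measure_integrable_cst.
  exact: integrableZl.
have i3 : P0.-integrable setT (fun w => (e1%:E * (Z w * \1_B w)%:E + e2%:E * (Z w)%:E)%E).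
  by apply: integrableD => //; exact: integrableZl.
have rhsE w : (rhs w)%:E = (((1 - c)%:E + (2 * c)%:E * (\1_B w)%:E) -
    (e1%:E * (Z w * \1_B w)%:E + e2%:E * (Z w)%:E))%E by [].
have irhs : P0.-integrable setT (fun w => (rhs w)%:E).
  by under eq_fun do rewrite rhsE; exact: integrableB.
have Erhs : (\int[P0]_w (rhs w)%:E =
    ((1 - c) + 2 * c * x - (e1 * y' + e2))%:E)%E.
  under eq_integral do rewrite rhsE.
  rewrite integralB// integralD//; last 2 first.
  - exact: finite_measure_integrable_cst.
  - exact: integrableZl.
  rewrite (integralD measurableT (integrableZl measurableT e1 iZB) (integrableZl measurableT e2 iZ)).
  rewrite !integralZl// -PB PT integral_indic// setIT.
  rewrite integral_cst// [X in (_ * X + _ - _)%E](probability_setT P0) mule1.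
  have P0x : P0 B = x%:E by rewrite fineK// fin_num_measure.
  have P1y : P1 B = y'%:E by rewrite fineK// fin_num_measure.
  rewrite [X in (_ + _ * X - _)%E]P0x [X in (_ - (_ * X + _))%E]P1y mule1.
  by rewrite -!EFinM -!EFinD.
have : (\int[P0]_w (rhs w)%:E <= \int[P0]_w (stopped_llr t w)%:E)%E.
  apply: le_integral => // w _; rewrite lee_fin /rhs /e1 /e2.
  have [Bw|Bw] := pselect (B w).
    rewrite indicE mem_set//; have := expR_ge1Dx (c - stopped_llr t w).
    by rewrite expRD -stopped_ratioE -/(Z w) /= !mulr1 => ?; lra.
  rewrite indicE memNset//; have := expR_ge1Dx (- c - stopped_llr t w).
  by rewrite expRD -stopped_ratioE -/(Z w) /= !mulr0 => ?; lra.
rewrite Erhs llrE lee_fin; apply: le_trans.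
have yy : y' <= y by rewrite -lee_fin fineK// fin_num_measure.
(* The relation between [c] and [y] reads [e1 * y + e2 = 1]; it cancels the constant 1 and leaves
   [c * (2 * x - 1)]. *)
have e1_0 : 0 <= e1 by rewrite subr_ge0 ler_expR; lra.
have : e1 * y' <= e1 * y by exact: ler_wpM2l.
rewrite -/x; move: cy; rewrite /e1 /e2 => ? ?; lra.
Qed.

End information.

(** * Expected numbers of pulls *)

Section stopping.
Context (R : realType) (K : nat) d (Omega : measurableType d)
  du (U : measurableType du) (L : learner R K Omega U)
  (Pi F : set 'cV[R]_K) (hL : admissible L Pi F)
  (Pi_simplex : Pi `<=` @simplex R K).

Definition recommends p : set Omega :=
  [set w | stop L w <> None /\ recommend L w = p].

Lemma history_recommends p t : history L t (recommends p `&` stopped_by L t).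
Proof.
have -> : recommends p `&` stopped_by L t = stopped_by L t `&`
    \bigcap_(a in [set: 'I_K]) (stopped_by L t `&`
      [set w | [set p a ord0] (recommend L w a ord0)]).
  apply/seteqP; split => w.
    by move=> [[_ <-] tw]; split => // a _; split.
  move=> [tw aw]; split => //; split; first by have [n -> _] := tw.
  by apply/matrixP => a b; rewrite (ord1 b); have [_] := aw a I.
apply: (@measurableI _ (history_space L t)); first exact: (stop_stopping_time hL).
apply: (@fin_bigcap_measurable _ (history_space L t)) => // a _.
exact: (recommend_measurable hL).
Qed.

Lemma recommends_bigcup p :
  recommends p = \bigcup_t (recommends p `&` stopped_by L t).
Proof.
apply/seteqP; split => [w [sw rw]|w [t _ []]//].
have [n sn] : exists n, stop L w = Some n by case: (stop L w) sw => // n; exists n.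
by exists n => //; split => //; exists n.
Qed.

Lemma measurable_recommends p : measurable (recommends p).
Proof.
rewrite recommends_bigcup; apply: bigcup_measurable => t _.
exact: (history_measurable hL (@history_recommends p t)).
Qed.

(** Continuity from below: a recommendation counts only if the learner stops, so the event is the
    increasing union of its parts stopped by [t]. *)
Lemma recommends_by_time (P : probability Omega R) p x : (x%:E < P (recommends p))%E ->
  exists t, (x%:E < P (recommends p `&` stopped_by L t))%E.
Proof.
move=> xP; apply: contrapT => H; move: xP; apply/negP; rewrite -leNgt.
have mH t : measurable (recommends p `&` stopped_by L t).
  exact: (history_measurable hL (@history_recommends p t)).
have cv : P (recommends p `&` stopped_by L t) @[t --> \oo] --> P (recommends p).
  rewrite [in X in _ --> X]recommends_bigcup.
  apply: (nondecreasing_cvg_mu (F := fun t => recommends p `&` stopped_by L t)) => //.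
    exact: bigcup_measurable.
  move=> s t st; apply/subsetPset; apply: setIS; exact: stopped_by_le.
rewrite -(cvg_lim _ cv)//; apply: lime_le; first by apply/cvg_ex; eexists; exact: cv.
by apply: nearW => t; rewrite leNgt; apply/negP => xt; apply: H; exists t.
Qed.

(** The expectation of the smaller of the stopping time and [t], as a sum of tail probabilities. *)
Definition rounds (P : probability Omega R) t : R :=
  \sum_(s < t) fine (P (~` stopped_by L s)).

Lemma rounds_ge0 P t : 0 <= rounds P t.
Proof. by apply: sumr_ge0 => s _; exact: fine_ge0. Qed.

Lemma measurable_running s : measurable (~` stopped_by L s).
Proof. exact: (history_measurable hL (history_running hL (t := s))). Qed.

(* The lower bound is measurable, so no measurability of the stopping time is
   needed: the integral of a nonnegative function is a supremum over simple
   functions below it. *)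
Lemma rounds_le_stop_time (P : probability Omega R) t :
  ((rounds P t)%:E <= \int[P]_w stop_time L w)%E.
Proof.
pose f w := (\sum_(s < t) \1_(~` stopped_by L s) w : R)%:E.
have st0 w : (0 <= stop_time L w)%E.
  by rewrite /stop_time; case: (stop L w) => [n|//]; rewrite lee_fin.
have f0 w : (0 <= f w)%E by rewrite lee_fin; apply: sumr_ge0.
have fst w : (f w <= stop_time L w)%E.
  rewrite /f /stop_time; case sw: (stop L w) => [n|]; last by rewrite leey.
  have -> : \sum_(s < t) \1_(~` stopped_by L s) w = (minn t n)%:R :> R.
    elim: t {f f0} => [|t IH]; first by rewrite big_ord0 min0n.
    rewrite big_ord_recr/= IH indicE; have [tn|nt] := ltnP t n.
      rewrite mem_set ?(minn_idPl _) ?natr1// 1?ltnW// => -[m]; rewrite sw => -[<-].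
      by rewrite leqNgt tn.
    rewrite memNset ?addr0 ?(minn_idPr _)//; first exact: leqW.
    by apply; exists n.
  by rewrite lee_fin ler_nat geq_minr.
apply: (@le_trans _ _ (\int[P]_w f w)%E).
  rewrite /f /rounds; under eq_integral do rewrite -sumEFin.
  rewrite ge0_integral_sum//.
    rewrite -sumEFin; apply: lee_sum => s _.
    rewrite integral_indic ?setIT//; last exact: measurable_running.
    by rewrite fineK// fin_num_measure//; exact: measurable_running.
  by move=> s; apply/measurable_EFinP; apply: measurable_indic; exact: measurable_running.
rewrite (ge0_integralTE _ f0) (ge0_integralTE _ st0).
apply: ereal_sup_le; apply: image_subset => h hf w.
exact: le_trans (hf w) (fst w).
Qed.

Context (P : probability Omega R).

(** A linear inequality valid for every exploration policy survives integration over the rounds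
    played. It serves for the total mass, with both signs, and for each row of the constraints. *)
Lemma pulls_affine t (b : 'I_K -> R) (beta : R) :
  (forall s w, \sum_(a < K) b a * explore L s w a ord0 <= beta) ->
  \sum_(a < K) b a * pulls L P t a <= beta * rounds P t.
Proof.
move=> bB; rewrite /pulls /rounds mulr_sumr.
under eq_bigr do rewrite mulr_sumr.
rewrite exchange_big/=; apply: ler_sum => s _.
have mS := measurable_running s.
have iE a := integrable_explore hL Pi_simplex P s a mS.
rewrite -lee_fin -sumEFin.
have -> : (\sum_(a < K) (b a * fine (\int[P]_(w in ~` stopped_by L s) (explore L s w a ord0)%:E))%:E =
    \int[P]_(w in ~` stopped_by L s) (\sum_(a < K) b a * explore L s w a ord0)%:E)%E.
  under eq_integral do rewrite -sumEFin.
  under eq_integral do under eq_bigr do rewrite EFinM.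
  rewrite integral_sum//; last by move=> a; exact: integrableZl.
  apply: eq_bigr => a _; rewrite integralZl// EFinM fineK//.
  exact: integrable_fin_num (iE a).
apply: (@le_trans _ _ (\int[P]_(w in ~` stopped_by L s) (cst beta%:E w))%E).
  apply: le_integral => //; last by move=> w _; rewrite lee_fin.
  - under eq_fun do rewrite -sumEFin.
    under eq_fun do under eq_bigr do rewrite EFinM.
    by apply: integrable_sum => // a _; exact: integrableZl.
  - exact: finite_measure_integrable_cst.
by rewrite integral_cst// EFinM fineK// fin_num_measure.
Qed.

Lemma pulls_ge0 t a : 0 <= pulls L P t a.
Proof.
apply: sumr_ge0 => s _; apply/fine_ge0/integral_ge0 => w _.
by rewrite lee_fin (explore_ge0 hL Pi_simplex).
Qed.

Lemma sum_pulls t : \sum_(a < K) pulls L P t a = rounds P t.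
Proof.
have E s w : \sum_(a < K) explore L s w a ord0 = 1.
  by have [_] := Pi_simplex (explore_feasible hL s w).
apply/eqP; rewrite eq_le; apply/andP; split.
  have := @pulls_affine t (fun=> 1) 1; rewrite mul1r.
  under eq_bigr do rewrite mul1r.
  by apply => s w; under eq_bigr do rewrite mul1r; rewrite E.
have := @pulls_affine t (fun=> -1) (-1); rewrite mulN1r.
under eq_bigr do rewrite mulN1r.
rewrite sumrN lerN2; apply => s w.
by under eq_bigr do rewrite mulN1r; rewrite sumrN E.
Qed.

(** The exploration policy averaged over the rounds played; it is the witness for the supremum in
    [char_time]. *)
Definition mean_policy t : 'cV[R]_K := \col_a (pulls L P t a / rounds P t).

Lemma mean_policy_simplex t : 0 < rounds P t -> simplex (mean_policy t).
Proof.
move=> S0; split; first by move=> a; rewrite mxE divr_ge0 ?pulls_ge0// ltW.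
under eq_bigr do rewrite mxE.
by rewrite -mulr_suml sum_pulls divff// gt_eqF.
Qed.

Lemma mean_policy_feasible N (B : 'M[R]_(N, K)) (c : 'cV[R]_N) t :
  Pi `<=` feasible B c -> 0 < rounds P t -> feasible B c (mean_policy t).
Proof.
move=> sub S0; split; first exact: mean_policy_simplex.
move=> i; rewrite mxE; under eq_bigr do rewrite mxE mulrA.
rewrite -mulr_suml ler_pdivrMr//; apply: pulls_affine => s w.
by have [_ /(_ i)] := sub _ (explore_feasible hL s w); rewrite mxE.
Qed.

End stopping.

(** * The lower bound *)

Lemma ln_odds_ge0 (R : realType) (delta : R) : 0 < delta -> delta <= 1 / 2 ->
  0 <= ln ((1 - delta) / delta).
Proof. by move=> d0 d2; rewrite ln_ge0// ler_pdivlMr//; lra. Qed.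

(** The relation between [c] and [y] asked by [information_lower_bound], at [y = delta]. *)
Lemma expR_ln_odds (R : realType) (delta : R) : 0 < delta -> delta <= 1 / 2 ->
  expR (ln ((1 - delta) / delta)) * delta +
  expR (- ln ((1 - delta) / delta)) * (1 - delta) = 1.
Proof.
move=> d0 d2; have d1 : 0 < 1 - delta by lra.
rewrite expRN lnK ?posrE ?divr_gt0//.
by field; rewrite !gt_eqF.
Qed.

Section pac_bound.
Context (R : realType) (K N : nat) (nu : exp_family R) (mu_min mu_max : R)
  (hmean : `[mu_min, mu_max] `<=` mean_space nu)
  (B : 'M[R]_(N, K)) (c : 'cV[R]_N)
  (mu pistar : 'cV[R]_K) (hmu : instances mu_min mu_max mu)
  (hpistar : optimal (feasible B c) mu = [set pistar])
  (d : measure_display) (Omega : measurableType d)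
  (du : measure_display) (U : measurableType du)
  (L : learner R K Omega U) (Pi : set 'cV[R]_K)
  (hL : admissible L Pi (feasible B c)) (Pi_simplex : Pi `<=` @simplex R K)
  (P : 'cV[R]_K -> probability Omega R)
  (hP : forall l, instances mu_min mu_max l -> bandit_law L nu l (P l))
  (delta : R) (hdelta0 : 0 < delta) (hdelta2 : delta <= 1 / 2)
  (hpac : pac L (feasible B c) (instances mu_min mu_max) P delta).

Let odds := ln ((1 - delta) / delta).

Lemma instances_mean_space (l : 'cV[R]_K) a : instances mu_min mu_max l -> mean_space nu (l a ord0).
Proof. by move=> Dl; apply: hmean; rewrite /= in_itv/=; exact: Dl. Qed.

(** Under [l] the learner recommends [p] with probability at least [1 - delta], which leaves at most
    [delta] for the disjoint event of recommending [pistar]. *)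
Lemma information_unique_optimum l p t :
  instances mu_min mu_max l -> optimal (feasible B c) l = [set p] -> p <> pistar ->
  odds * (2 * fine (P mu (recommends L pistar `&` stopped_by L t)) - 1) <=
  \sum_(a < K) pulls L (P mu) t a * kld nu (mu a ord0) (l a ord0).
Proof.
move=> Dl optl pne.
apply: (information_lower_bound hL Pi_simplex
  (fun a => instances_mean_space a hmu) (fun a => instances_mean_space a Dl)
  (hP hmu) (hP Dl) (y := delta)).
- by move=> s; exact: (history_recommends hL).
- exact: ln_odds_ge0.
- exact: expR_ln_odds.
have mB : measurable (recommends L pistar `&` stopped_by L t).
  exact: (history_measurable hL (history_recommends hL pistar (t := t))).
have mC := measurable_recommends hL p.
have dis : [disjoint recommends L pistar `&` stopped_by L t & recommends L p].
  by apply/disj_setPS => w [[[_ rw] _] [_ rw']]; apply: pne; rewrite -rw -rw'.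
have := @probability_le1 _ _ _ (P l) _ (measurableU _ _ mB mC).
rewrite measureU//; last exact/eqP.
set A := _ `&` _ in mB dis * => le1.
have : (P l A + (1 - delta)%:E <= 1)%E.
  by apply: le_trans le1; apply: leeD2l; exact: hpac Dl optl.
by rewrite -leeBrDr// -EFinB opprB addrCA subrr addr0.
Qed.

Lemma information_alternative l t :
  alternatives (feasible B c) mu_min mu_max pistar l ->
  odds * (2 * fine (P mu (recommends L pistar `&` stopped_by L t)) - 1) <=
  \sum_(a < K) pulls L (P mu) t a * kld nu (mu a ord0) (l a ord0).
Proof.
move=> altl; have [Dl _] := altl.
have [C C0 towards] := kld_towards hmean.
apply/ler_addgt0Pr => e e0.
pose S := rounds L (P mu) t.
have S0 : 0 <= S := rounds_ge0 L (P mu) t.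
(* Replacing [l] by [l'] costs at most [C * eps] per pull, hence at most [C * S * eps <= e] in
   total; the 1 keeps the denominator positive. *)
pose eps := e / (C * S + 1).
have CS0 : 0 < C * S + 1 by rewrite ltr_wpDl// mulr_ge0.
have eps0 : 0 < eps by rewrite divr_gt0.
have [l' [p' [Dl' optl' p'ne near]]] := alternative_perturbation hmu hpistar altl eps0.
apply: (le_trans (information_unique_optimum t Dl' optl' p'ne)).
apply: (@le_trans _ _ (\sum_(a < K) (pulls L (P mu) t a * kld nu (mu a ord0) (l a ord0) +
   pulls L (P mu) t a * (C * eps)))).
  apply: ler_sum => a _; rewrite -mulrDr; apply: ler_wpM2l.
    exact: (pulls_ge0 hL Pi_simplex).
  have [sgn le] := near a.
  apply: (le_trans (towards _ _ _ (hmu a) (Dl a) (Dl' a) sgn)).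
  by rewrite lerD2l ler_wpM2l.
rewrite big_split/= lerD2l -mulr_suml (sum_pulls hL Pi_simplex) -/S.
rewrite /eps mulrA mulrA ler_pdivrMr// mulrDr mulr1.
by rewrite (_ : S * C * e = e * (C * S)) ?lerDl ?ltW//; ring.
Qed.

Lemma confident_time e : 0 < e ->
  exists t, 1 - delta - e < fine (P mu (recommends L pistar `&` stopped_by L t)).
Proof.
move=> e0; have [|t Ht] := @recommends_by_time _ _ _ _ _ _ _ _ _ hL (P mu) pistar (1 - delta - e).
  apply: lt_le_trans (hpac hmu hpistar).
  by rewrite lte_fin ltrBlDr ltrDl.
exists t; rewrite -lte_fin fineK// fin_num_measure//.
exact: (history_measurable hL (history_recommends hL pistar (t := t))).
Qed.

End pac_bound.

(** Passage to the limit in the extended reals, with [v] the supremum over policies and [I] the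
    expected stopping time. Letting [e] tend to 0 gives [k / r <= v]; an infinite [I] bounds
    everything and an infinite [v] has inverse 0. *)
Lemma inve_mul_le (R : realType) (v I : \bar R) (k : R) :
  (0 <= I)%E -> 0 <= k ->
  (forall e r, 0 < e -> e < k -> I = r%:E ->
    0 < r /\ (((k - e) / r)%:E <= v)%E) ->
  (inve v * k%:E <= I)%E.
Proof.
move=> I0; rewrite le_eqVlt => /predU1P[<-|k0] H; first by rewrite mule0.
case: I I0 H => [r| |//] I0 H; last by rewrite leey.
have k20 : 0 < k / 2 by rewrite divr_gt0.
have k2k : k / 2 < k by lra.
have [r0 _] := H _ r k20 k2k erefl.
have vk : ((k / r)%:E <= v)%E.
  apply/lee_addgt0Pr => e e0.
  (* The bound [e * r] makes the loss after division by [r] at most [e], and [k / 2] keeps [e']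
     below [k]. *)
  pose e' := Num.min (e * r) (k / 2).
  have e'0 : 0 < e' by rewrite lt_min mulr_gt0.
  have e'k : e' < k.
    by apply: le_lt_trans k2k; rewrite ge_min lexx orbT.
  have [_ le] := H e' r e'0 e'k erefl.
  rewrite -leeBlDr//; apply: le_trans le; rewrite -EFinB lee_fin mulrBl lerD2l lerN2.
  by rewrite ler_pdivrMr// ge_min lexx.
case: v vk {H} => [v| |//] vk; last by rewrite invey mul0e.
rewrite lee_fin in vk; have v0 : 0 < v by apply: lt_le_trans vk; rewrite divr_gt0.
rewrite inver gt_eqF// -EFinM lee_fin mulrC ler_pdivrMr//.
by rewrite -ler_pdivrMl// mulrC.
Qed.

Theorem theorem5 (R : realType) (K N : nat)
  (nu : exp_family R) (hnu : sub_gaussian_family nu)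
  (mu_min mu_max : R) (hmean : `[mu_min, mu_max] `<=` mean_space nu)
  (B : 'M[R]_(N, K)) (c : 'cV[R]_N) (hF : feasible B c !=set0)
  (mode : constraint_mode)
  (mu pistar : 'cV[R]_K) (hmu : instances mu_min mu_max mu)
  (hpistar : optimal (feasible B c) mu = [set pistar])
  (d : measure_display) (Omega : measurableType d)
  (du : measure_display) (U : measurableType du)
  (L : learner R K Omega U)
  (hL : admissible L (exploration_set mode (feasible B c)) (feasible B c))
  (P : 'cV[R]_K -> probability Omega R)
  (hP : forall l, instances mu_min mu_max l -> bandit_law L nu l (P l))
  (delta : R) (hdelta0 : 0 < delta) (hdelta2 : delta <= 1 / 2)
  (hpac : pac L (feasible B c) (instances mu_min mu_max) P delta) :
  (char_time nu (exploration_set mode (feasible B c))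
       (alternatives (feasible B c) mu_min mu_max pistar) mu
     * bernoulli_kl delta (1 - delta)
   <= \int[P mu]_w stop_time L w)%E.
Proof.
set F := feasible B c in hF hpistar hL hpac *.
set Pi := exploration_set mode F in hL *.
set Lambda := alternatives _ _ _ _.
have FPi : F `<=` Pi by rewrite /Pi; case: (mode) => [p []|].
have Pi_simplex : Pi `<=` @simplex R K by rewrite /Pi; case: (mode) => [//|p []].
have [Fpistar _] : optimal F mu pistar by rewrite hpistar.
have st0 : (0 <= \int[P mu]_w stop_time L w)%E.
  apply: integral_ge0 => w _; rewrite /stop_time.
  by case: (stop L w) => [n|//]; rewrite lee_fin.
rewrite bernoulli_klE// /char_time.
(* Without alternatives every infimum is [+oo], so the supremum is [+oo] and the characteristic time
   is 0. *)
have [Lambda0|/set0P[l0 Ll0]] := eqVneq Lambda set0.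
  rewrite [X in inve X](_ : _ = +oo%E) ?invey ?mul0e//.
  apply/eqP; rewrite -leye_eq; apply: ereal_sup_ubound => /=.
  exists pistar; first exact: FPi.
  by rewrite Lambda0 image_set0 ereal_inf0.
have k0 : 0 <= ln ((1 - delta) / delta) := ln_odds_ge0 hdelta0 hdelta2.
set odds := ln _ in k0 *.
apply: inve_mul_le => //; first by rewrite mulr_ge0//; lra.
move=> e r e0 ek IE.
have odds0 : 0 < odds.
  rewrite lt_neqAle k0 andbT; apply/eqP => o0.
  by move: ek; rewrite -o0 mulr0 => /(lt_trans e0); rewrite ltxx.
(* The slack [e / (2 * odds)] becomes exactly [e] after multiplication by [2 * odds] in [kx]. *)
have [t tE] : exists t, 1 - delta - e / (2 * odds) <
    fine (P mu (recommends L pistar `&` stopped_by L t)).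
  by apply: (confident_time hmu hpistar hL hpac); rewrite divr_gt0// mulr_gt0.
set x := fine _ in tE.
have kx : (1 - 2 * delta) * odds - e <= odds * (2 * x - 1).
  have -> : (1 - 2 * delta) * odds - e = odds * (2 * (1 - delta - e / (2 * odds)) - 1).
    by field; rewrite gt_eqF.
  by rewrite ler_wpM2l// lerD2r ler_wpM2l// ltW.
pose S := rounds L (P mu) t.
have info l : Lambda l -> (1 - 2 * delta) * odds - e <=
    \sum_(a < K) pulls L (P mu) t a * kld nu (mu a ord0) (l a ord0).
  move=> Ll; apply: le_trans kx _.
  exact: (information_alternative hmean hmu hpistar hL Pi_simplex hP hdelta0 hdelta2 hpac t Ll).
have ke : 0 < (1 - 2 * delta) * odds - e by rewrite subr_gt0.
(* If no round were played on average, all the pulls would vanish, against the positive information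
   bound for [l0]. *)
have S0 : 0 < S.
  rewrite lt_neqAle rounds_ge0 andbT; apply/eqP => S0.
  have := lt_le_trans ke (info _ Ll0); rewrite big1 ?ltxx// => a _.
  have /psumr_eq0P : \sum_(a < K) pulls L (P mu) t a = 0.
    by rewrite (sum_pulls hL Pi_simplex).
  move=> /(_ (fun a _ => pulls_ge0 hL Pi_simplex (P mu) t a)) ->//.
  by rewrite mul0r.
have Sr : S <= r by rewrite -lee_fin -IE; exact: (rounds_le_stop_time hL).
have r0 : 0 < r by exact: lt_le_trans Sr.
split=> //.
(* Dividing by [S] instead of [r] only strengthens the bound, and it turns the pulls into the
   weights of [mean_policy]. *)
apply: (@le_trans _ _ (((1 - 2 * delta) * odds - e) / S)%:E).
  by rewrite lee_fin ler_wpM2l ?(ltW ke)// lef_pV2.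
pose w := mean_policy L (P mu) t.
have Pw : Pi w.
  have [PiE|PiE] : Pi = @simplex R K \/ Pi = F by rewrite /Pi; case: (mode); [left|right].
    by rewrite PiE; exact: (mean_policy_simplex hL).
  rewrite PiE; apply: (mean_policy_feasible hL) => //.
  by rewrite PiE.
apply: (@le_trans _ _ (ereal_inf [set (\sum_(a < K) (w a ord0)%:E *
   KL (nu (mu a ord0)) (nu (l a ord0)))%E | l in Lambda])); last first.
  by apply: ereal_sup_ubound; exists w.
apply: le_ereal_inf_tmp => _ [l Ll <-]; have [Dl _] := Ll.
rewrite (_ : (\sum_(a < K) _)%E =
  ((\sum_(a < K) pulls L (P mu) t a * kld nu (mu a ord0) (l a ord0)) / S)%:E).
  by rewrite lee_fin ler_wpM2r ?invr_ge0 ?(ltW S0)// info.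
rewrite mulr_suml -sumEFin; apply: eq_bigr => a _.
rewrite (KL_family (instances_mean_space hmean a hmu) (instances_mean_space hmean a Dl)).
by rewrite -EFinM mxE mulrAC.
Qed.
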